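(* Let $c\in\mathbb{R}$, let $y:M\to Q^4_1$ be a spacelike isothermic surface with adapted coordinate $z$, and let $y^c:M\to Q^4_1$ be a spectral transform of $y$ with parameter $c$, both $y$ and $y^c$ being spacelike isothermic surfaces with the same adapted coordinate $z$. Let $[L]$ and $[L^c]$ be the left polar surfaces of $y$ and $y^c$ respectively. If $[L]$ and $[L^c]$ are non-degenerate, then $[L^c]$ is a spectral transform of $[L]$ with the same parameter $c$ (with respect to the coordinate $z$). Likewise, if the right polar surfaces $[R]$ of $y$ and $[R^c]$ of $y^c$ are non-degenerate, then $[R^c]$ is a spectral transform of $[R]$ with parameter $c$.
   Context: $\mathbb{R}^6_2$ is $\mathbb{R}^6$ with the quadratic form $\langle x,x\rangle=\sum_{i=1}^4x_i^2-x_5^2-x_6^2$ (extended complex-bilinearly to $\mathbb{C}^6$) and a fixed orientation; $C^5$ is its light cone, and $Q^4_1=\{[x]\in\mathbb{R}P^5: x\in C^5\setminus\{0\}\}$, with projection $\pi:C^5\setminus\{0\}\to Q^4_1$. All maps are smooth. A local lift of $y:M\to Q^4_1$ on an open set $U$ is a map $Y:U\to C^5\setminus\{0\}$ with $\pi\circ Y=y$; we write $y=[Y]$. Conformal spacelike surface: an immersion $y:M\to Q^4_1$ of a Riemann surface $M$ such that $\langle Y_z,Y_z\rangle=0$ and $\langle Y_z,Y_{\bar z}\rangle>0$ for any local lift $Y$ and any complex coordinate $z$. Then $M\times\mathbb{R}^6_2=V\oplus V^\perp$, where $V=\mathrm{Span}\{Y,\mathrm{Re}(Y_z),\mathrm{Im}(Y_z),Y_{z\bar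 z}\}$ is a Lorentzian rank-4 bundle, independent of the choice of $Y$ and $z$, and $V^\perp$ is a Lorentzian rank-2 bundle (the normal bundle), with induced normal connection $D$. Canonical lift with respect to a complex coordinate $z=u+\mathrm{i}v$: the local lift $Y$ (unique up to sign) with $|\mathrm{d}Y|^2=|\mathrm{d}z|^2$. With $Y$ canonical, $N\in\Gamma(V)$ is determined by $\langle N,Y_z\rangle=\langle N,Y_{\bar z}\rangle=\langle N,N\rangle=0$, $\langle N,Y\rangle=-1$. One has $Y_{zz}=-\frac{s}{2}Y+\kappa$ with a complex function $s$ (the Schwarzian derivative) and a section $\kappa$ of $V^\perp\otimes\mathbb{C}$ (the conformal Hopf differential). A point is umbilic if $\kappa=0$ there. Isothermic: a conformal spacelike surface $y$ without umbilic points is called isothermic if around each point of $M$ there is a complex coordinate $z$ such that, for the canonical lift with respect to $z$, $\kappa$ is real-valued (i.e. $\kappa=\bar\kappa$). Such a $z$ is called an adapted coordinate. Here a single adapted coordinate $z$ is fixed and $M$ is its domain. Normal frames and polar surfaces: locally choose a frame $\{L,R\}$ of $V^\perp$ with $\langle L,L\rangle=\langle R,R\rangle=0$, $\langle L,R\rangle=-1$ and such that $\{Y,Y_u,Y_v,N,R,L\}$ is positively oriented in $\mathbb{R}^6_2$; it is unique up to $L\mapsto aL$, $R\mapsto a^{-1}R$ with $a$ a nowhere vanishing real function. The maps $[L],[R]:M\to Q^4_1$ are called the left and the right polar surface of $y=[Y]$. Write $\kappa=\lambda_1L+\lambda_2R$ and $D_zL=\alpha L$, $D_zR=-\alpha R$.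 A polar surface is called non-degenerate if it is an immersion ($[L]$ is degenerate exactly where $\lambda_2=0$, $[R]$ exactly where $\lambda_1=0$). Known fact used for the claim to make sense: non-degenerate polar surfaces of a spacelike isothermic surface are spacelike isothermic with the same adapted coordinate. Spectral transform: given isothermic $y=[Y]$ with adapted coordinate $z$ and $c\in\mathbb{R}$, an isothermic surface $y^c=[Y^c]:M\to Q^4_1$ with the same adapted coordinate $z$ is called a spectral transform of $y$ with parameter $c$ if around each point, for the canonical lifts $Y,Y^c$ with respect to $z$ and for suitable frames $\{L,R\}$, $\{L^c,R^c\}$ of the respective normal bundles (with $\langle L,L\rangle=\langle R,R\rangle=0$, $\langle L,R\rangle=-1$ and $\{Y,Y_u,Y_v,N,R,L\}$ positively oriented in $\mathbb{R}^6_2$, and likewise $\langle L^c,L^c\rangle=\langle R^c,R^c\rangle=0$, $\langle L^c,R^c\rangle=-1$ and $\{Y^c,Y^c_u,Y^c_v,N^c,R^c,L^c\}$ positively oriented in $\mathbb{R}^6_2$, where $N^c$ is the section determined by $Y^c$ in the same way as $N$ is determined by $Y$), the corresponding invariants satisfy $s^c=s+c$, $\lambda_1^c=\lambda_1$, $\lambda_2^c=\lambda_2$, $\alpha^c=\alpha$. *)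

(* Defs.v *)
From HB Require Import structures.
From mathcomp Require Import all_boot all_order all_algebra.
From mathcomp Require Import complex.
From mathcomp Require Import all_classical all_reals all_analysis.

Set Implicit Arguments.
Unset Strict Implicit.
Unset Printing Implicit Defensive.

Import Order.TTheory GRing.Theory Num.Theory.
Import numFieldNormedType.Exports.

Local Open Scope classical_set_scope.
Local Open Scope ring_scope.

(* Over R this is the metric of R^6_2; over R[i] it is its complex-bilinear
   (not Hermitian) extension to C^6. *)
Definition qf (K : comPzRingType) (x y : 'rV[K]_6) : K :=
  \sum_(i < 6 | (i < 4)%N) x 0 i * y 0 i
  - \sum_(i < 6 | (4 <= i)%N) x 0 i * y 0 i.

(* The projective quadric Q^4_1: its points are the isotropic lines of R^6_2. *)
Record quadric (R : realType) : Type := Quadric {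
  line :> {vspace 'rV[R]_6};
  dim_line : \dim line = 1%N;
  isotropic_line : forall v, v \in line -> qf v v = 0
}.

(* Points z = u + iv of the complex plane are the pairs (u, v) : R * R, and maps
   defined on an open set are total functions with irrelevant values outside. *)
Section Surfaces.
Variable R : realType.
Implicit Types (M W : set (R * R)) (p w : R * R) (y : R * R -> quadric R).

Definition e_u : R * R := (1, 0).
Definition e_v : R * R := (0, 1).

Fixpoint of_class (V : normedModType R) (k : nat) W (f : R * R -> V) : Prop :=
  match k with
  | 0 => forall p, W p -> {for p, continuous f}
  | k'.+1 => [/\ forall p, W p -> differentiable f p,
                 of_class k' W (fun p => 'D_e_u f p)
               & of_class k' W (fun p => 'D_e_v f p)]
  end.

Definition smooth (V : normedModType R) W (f : R * R -> V) : Prop :=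
  forall k, of_class k W f.

Definition toC (x : 'rV[R]_6) : 'rV[R[i]]_6 := map_mx (fun a => a%:C%C) x.
Definition reV (x : 'rV[R[i]]_6) : 'rV[R]_6 := map_mx (@complex.Re R) x.
Definition imV (x : 'rV[R[i]]_6) : 'rV[R]_6 := map_mx (@complex.Im R) x.
Definition conjV (x : 'rV[R[i]]_6) : 'rV[R[i]]_6 := map_mx conjc x.

Definition derivC w (F : R * R -> 'rV[R[i]]_6) p : 'rV[R[i]]_6 :=
  toC ('D_w (reV \o F) p) + 'i%C *: toC ('D_w (imV \o F) p).

Definition dz (F : R * R -> 'rV[R[i]]_6) p : 'rV[R[i]]_6 :=
  2^-1 *: (derivC e_u F p - 'i%C *: derivC e_v F p).
Definition dzbar (F : R * R -> 'rV[R[i]]_6) p : 'rV[R[i]]_6 :=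
  2^-1 *: (derivC e_u F p + 'i%C *: derivC e_v F p).

Definition Yz (Y : R * R -> 'rV[R]_6) : R * R -> 'rV[R[i]]_6 := dz (toC \o Y).
Definition Yzbar (Y : R * R -> 'rV[R]_6) : R * R -> 'rV[R[i]]_6 :=
  dzbar (toC \o Y).

Definition open_in M W : Prop := open W /\ W `<=` M.

Definition local_lift W y (Y : R * R -> 'rV[R]_6) : Prop :=
  smooth W Y /\
  forall p, W p -> [/\ qf (Y p) (Y p) = 0, Y p != 0
                     & line (y p) = <[Y p]>%VS].

Definition smooth_map M y : Prop :=
  forall p, M p -> exists W Y, [/\ open_in M W, W p & local_lift W y Y].

(* T_l RP^5 = Hom(l, R^6 / l), and the differential of y = [Y] sends a tangent
   vector w to (Y |-> D_w Y mod Y). *)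
Definition immersion M y : Prop :=
  smooth_map M y /\
  forall W Y, open_in M W -> local_lift W y Y ->
  forall p w, W p -> 'D_w Y p \in <[Y p]>%VS -> w = 0.

(* phi is the inverse of a complex coordinate defined on the open subset
   phi(O) of M and with values in O; the last clause is the Cauchy-Riemann
   equations together with phi' <> 0. *)
Definition coordinate_inverse M (O : set (R * R)) (phi : R * R -> R * R) : Prop :=
  [/\ open O, forall p, O p -> M (phi p), smooth O phi,
      forall p q, O p -> O q -> phi p = phi q -> p = q
    & forall p, O p ->
        'D_e_v phi p = (- ('D_e_u phi p).2, ('D_e_u phi p).1) /\
        'D_e_u phi p <> 0].

Definition conformal_spacelike M y : Prop :=
  immersion M y /\
  forall O phi Y, coordinate_inverse M O phi -> local_lift O (y \o phi) Y ->
  forall p, O p -> qf (Yz Y p) (Yz Y p) = 0 /\ 0 < qf (Yz Y p) (Yzbar Y p).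

(* Y_{z zbar} is real, whence its real part. *)
Definition bundleV (Y : R * R -> 'rV[R]_6) p : {vspace 'rV[R]_6} :=
  <<[:: Y p; reV (Yz Y p); imV (Yz Y p); reV (dzbar (Yz Y) p)]>>%VS.

Definition normal Y p (x : 'rV[R]_6) : Prop :=
  forall v, v \in bundleV Y p -> qf x v = 0.
Definition normalC Y p (x : 'rV[R[i]]_6) : Prop :=
  normal Y p (reV x) /\ normal Y p (imV x).
Definition tangentC Y p (x : 'rV[R[i]]_6) : Prop :=
  reV x \in bundleV Y p /\ imV x \in bundleV Y p.

(* D_z psi = chi at p: chi is the V^perp-component of psi_z. *)
Definition is_Dz Y (psi : R * R -> 'rV[R]_6) p (chi : 'rV[R[i]]_6) : Prop :=
  normalC Y p chi /\ tangentC Y p (dz (toC \o psi) p - chi).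

Definition canonical_lift W y (Y : R * R -> 'rV[R]_6) : Prop :=
  local_lift W y Y /\
  forall p w, W p -> qf ('D_w Y p) ('D_w Y p) = w.1 ^+ 2 + w.2 ^+ 2.

Definition is_N W Y (N : R * R -> 'rV[R]_6) : Prop :=
  smooth W N /\
  forall p, W p ->
    [/\ N p \in bundleV Y p,
        qf (toC (N p)) (Yz Y p) = 0, qf (toC (N p)) (Yzbar Y p) = 0,
        qf (N p) (N p) = 0 & qf (N p) (Y p) = -1].

Definition schwarzian_hopf W Y (s : R * R -> R[i])
    (kappa : R * R -> 'rV[R[i]]_6) : Prop :=
  forall p, W p ->
    dz (Yz Y) p = - (s p / 2) *: toC (Y p) + kappa p /\ normalC Y p (kappa p).

Definition isothermic M y : Prop :=
  conformal_spacelike M y /\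
  forall W Y s kappa, open_in M W -> canonical_lift W y Y ->
    schwarzian_hopf W Y s kappa ->
    forall p, W p -> kappa p <> 0 /\ kappa p = conjV (kappa p).

(* [o] selects which of the two orientations of R^6_2 is the fixed one
   (the standard one for [o = false]). *)
Definition positively_oriented (o : bool) (b : seq 'rV[R]_6) : Prop :=
  0 < (-1) ^+ o * \det (\matrix_(i < 6) nth 0 b i).

Definition normal_frame (o : bool) W Y (N Lf Rt : R * R -> 'rV[R]_6) : Prop :=
  [/\ smooth W Lf, smooth W Rt &
  forall p, W p ->
    [/\ normal Y p (Lf p) /\ normal Y p (Rt p),
        qf (Lf p) (Lf p) = 0, qf (Rt p) (Rt p) = 0, qf (Lf p) (Rt p) = -1
      & positively_oriented o
          [:: Y p; 'D_e_u Y p; 'D_e_v Y p; N p; Rt p; Lf p]]].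

Definition canonical_framing (o : bool) W y Y N Lf Rt : Prop :=
  [/\ canonical_lift W y Y, is_N W Y N & normal_frame o W Y N Lf Rt].

Definition left_polar (o : bool) M y (l : R * R -> quadric R) : Prop :=
  forall p, M p -> exists W Y N Lf Rt,
    [/\ open_in M W, W p, canonical_framing o W y Y N Lf Rt
      & forall q, W q -> line (l q) = <[Lf q]>%VS].

Definition right_polar (o : bool) M y (r : R * R -> quadric R) : Prop :=
  forall p, M p -> exists W Y N Lf Rt,
    [/\ open_in M W, W p, canonical_framing o W y Y N Lf Rt
      & forall q, W q -> line (r q) = <[Rt q]>%VS].

Definition invariants W Y (Lf Rt : R * R -> 'rV[R]_6)
    (s lambda1 lambda2 alpha : R * R -> R[i]) : Prop :=
  schwarzian_hopf W Y s
    (fun p => lambda1 p *: toC (Lf p) + lambda2 p *: toC (Rt p)) /\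
  forall p, W p ->
    is_Dz Y Lf p (alpha p *: toC (Lf p)) /\
    is_Dz Y Rt p (- alpha p *: toC (Rt p)).

Definition spectral_transform (o : bool) M (c : R) y yc : Prop :=
  [/\ isothermic M y, isothermic M yc &
  forall p, M p ->
    exists W Y N Lf Rt Yc Nc Lfc Rtc,
    exists s lambda1 lambda2 alpha sc lambda1c lambda2c alphac,
    [/\ open_in M W /\ W p,
        canonical_framing o W y Y N Lf Rt
          /\ invariants W Y Lf Rt s lambda1 lambda2 alpha,
        canonical_framing o W yc Yc Nc Lfc Rtc
          /\ invariants W Yc Lfc Rtc sc lambda1c lambda2c alphac
      & forall q, W q ->
          [/\ sc q = s q + c%:C%C, lambda1c q = lambda1 q,
              lambda2c q = lambda2 q & alphac q = alpha q]]].

End Surfaces.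

(* Main.v *)
(* In the coordinate z = u + iv, write the canonical lift as Y and the Hopf differential as
   kappa = l1 L + l2 R. The equation L_z = alpha L - 2 g Y + 2 l2 Y_zbar, with
   g = (D_zbar kappa)_R, shows that [L] is an immersion exactly where l2 does not vanish.
   Rescaling L by 1 / (2 l2) one may assume l2 = 1/2, and then L itself is the canonical
   lift of [L]. The mixed partials of L agree, which gives L_z = alpha L + conj(alpha) Y + Y_zbar,
   and the Gauss equation gives Y_{z zbar} = l1 Y + N / 2. It follows that the normal bundle of
   [L] is spanned by its right null section Y and a left null section X (with <X, Y> = -1),
   and that the invariants of [L] in the frame {X, Y} are
     s - 4 alpha_z, l1' = 1/2, l2' = l1 + (conj alpha)_z, alpha.
   They depend on s, l1, alpha only, and adding c to s adds c to the new Schwarzian.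
   The right polar surface reduces to the left one: exchanging L and R reverses the
   orientation. *)

(* The obstacle is that the definitions speak of every lift, coordinate and frame. Both surfaces are
   therefore described by real structure equations in u and v for one frame on an open set, where
   each invariant is a pairing of derivatives. Translating the result back rests on two uniqueness
   facts: a canonical lift is unique up to sign, and the orientation tells the two null normal lines
   apart. With l2 = 1/2, the derivatives L_u and L_v are Y_u and -Y_v up to terms in Y and L, so L
   induces the same flat metric as Y. The minus sign is decisive: L_uu + L_vv contains Y_uu - Y_vv,
   that is the Hopf differential of Y, while L_uu - L_vv contains the Laplacian of Y. The two
   exchange their roles, and so do tangential and normal null vectors. Since lambda_2 is the same
   for y and y^c, one rescaling function normalises both surfaces at once and keeps their other
   invariants comparable. *)
Require Import Defs.
From HB Require Import structures.
From mathcomp Require Import all_boot all_order all_algebra.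
From mathcomp Require Import fingroup perm complex ring lra.
From mathcomp Require Import all_classical all_reals all_analysis.
Set Implicit Arguments.
Unset Strict Implicit.
Unset Printing Implicit Defensive.
Import Order.TTheory GRing.Theory Num.Theory.
Import numFieldNormedType.Exports.
Local Open Scope classical_set_scope.
Local Open Scope ring_scope.

(** * Smooth maps on open subsets of the plane *)

Section LocalEquality.
Variables (R : realType) (U V : normedModType R).
Implicit Types f g : U -> V.

(** The first-order expansion of [f] at [x] is also one of [g], and [diff_unique] identifies its
    linear part with the differential of [g]. This locality is needed because maps on an open set
    are total functions with arbitrary values outside. *)
Lemma eq_near_differentiable f g (x : U) :
  (\forall y \near x, f y = g y) -> differentiable f x -> differentiable g x.
Proof.
move=> fg /diff_locallyP[cdf dfx].
have fgx : f x = g x by exact: nbhs_singleton fg.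
suff gE : g \o shift x = cst (g x) + 'd f x +o_ 0 id.
  by apply/diff_locallyP; rewrite (diff_unique cdf gE).
apply/eqaddoP => e e0; have /eqaddoP /(_ e e0) := dfx.
have: \forall h \near 0, f (h + x) = g (h + x).
  by move: fg; rewrite (near_shift 0 x) /=; apply: filterS => h; rewrite subr0.
apply: filterS2 => h fgh; rewrite -fgx.
by rewrite /= -![(_ + _ : _ -> _) _]/(_ + _) -![(- _ : _ -> _) _]/(- _) /= fgh.
Qed.

End LocalEquality.

Section Smooth.
Variable R : realType.
Implicit Types (V : normedModType R) (W : set (R * R)).

Lemma open_near W (P : R * R -> Prop) p :
  open W -> W p -> (forall q, W q -> P q) -> \forall q \near p, P q.
Proof. by move=> oW Wp WP; apply: filterS WP _; exact: open_nbhs_nbhs. Qed.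

Lemma eq_on_derive V W (f g : R * R -> V) w p :
  open W -> (forall q, W q -> f q = g q) -> W p -> 'D_w f p = 'D_w g p.
Proof. by move=> oW fg Wp; apply: near_eq_derive; exact: open_near fg. Qed.

Lemma of_class_ext V W k (f g : R * R -> V) :
  open W -> (forall p, W p -> f p = g p) -> of_class k W f -> of_class k W g.
Proof.
move=> oW; elim: k f g => [|k IH] f g fg /=.
  move=> cf p Wp; rewrite /prop_for /continuous_at -(fg p Wp).
  by apply: cvg_trans (cf p Wp); apply: near_eq_cvg; exact: open_near fg.
move=> [df duf dvf]; split.
- by move=> p Wp; apply: eq_near_differentiable (df p Wp); exact: open_near fg.
- by apply: IH duf => p Wp; exact: eq_on_derive fg Wp.
- by apply: IH dvf => p Wp; exact: eq_on_derive fg Wp.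
Qed.

Lemma of_classS V W k (f : R * R -> V) : of_class k.+1 W f -> of_class k W f.
Proof.
elim: k f => [|k IH] f; first by move=> [df _ _] p Wp; exact/differentiable_continuous/df.
by move=> [df duf dvf]; split; [exact: df|exact: IH duf|exact: IH dvf].
Qed.

Lemma of_class_sub V W W' k (f : R * R -> V) :
  W' `<=` W -> of_class k W f -> of_class k W' f.
Proof.
move=> W'W; elim: k f => [|k IH] f /=; first by move=> cf p /W'W /cf.
by move=> [df duf dvf]; split; [move=> p /W'W /df|exact: IH|exact: IH].
Qed.

Lemma smooth_ext V W (f g : R * R -> V) :
  open W -> (forall p, W p -> f p = g p) -> smooth W f -> smooth W g.
Proof. by move=> oW fg sf k; exact: of_class_ext (sf k). Qed.

Lemma smooth_sub V W W' (f : R * R -> V) :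
  W' `<=` W -> smooth W f -> smooth W' f.
Proof. by move=> W'W sf k; exact: of_class_sub (sf k). Qed.

Lemma smooth_differentiable V W (f : R * R -> V) p :
  smooth W f -> W p -> differentiable f p.
Proof. by move=> /(_ 1%N)[df _ _] /df. Qed.

Lemma smooth_derivable V W (f : R * R -> V) w p :
  smooth W f -> W p -> derivable f p w.
Proof. by move=> sf Wp; exact/diff_derivable/(smooth_differentiable sf). Qed.

Lemma smooth_Du V W (f : R * R -> V) :
  smooth W f -> smooth W (fun p => 'D_(e_u R) f p).
Proof. by move=> sf k; case: (sf k.+1). Qed.

Lemma smooth_Dv V W (f : R * R -> V) :
  smooth W f -> smooth W (fun p => 'D_(e_v R) f p).
Proof. by move=> sf k; case: (sf k.+1). Qed.

Lemma derive_basis V (f : R * R -> V) p w : differentiable f p ->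
  'D_w f p = w.1 *: 'D_(e_u R) f p + w.2 *: 'D_(e_v R) f p.
Proof.
move=> df; rewrite !deriveE// -!linearZ -linearD; congr ('d f p _).
by case: w => a b; congr pair; rewrite /= !(scaler0, addr0, add0r) /GRing.scale/= mulr1.
Qed.

Lemma of_classD V W k (f g : R * R -> V) : open W ->
  of_class k W f -> of_class k W g -> of_class k W (fun p => f p + g p).
Proof.
move=> oW; elim: k f g => [|k IH] f g /=.
  by move=> cf cg p Wp; apply: continuousD; [exact: cf|exact: cg].
move=> [df duf dvf] [dg dug dvg]; split.
- by move=> p Wp; apply: differentiableD; [exact: df|exact: dg].
- apply: (of_class_ext oW _ (IH _ _ duf dug)) => p Wp.
  by rewrite deriveD//; [exact/diff_derivable/df|exact/diff_derivable/dg].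
- apply: (of_class_ext oW _ (IH _ _ dvf dvg)) => p Wp.
  by rewrite deriveD//; [exact/diff_derivable/df|exact/diff_derivable/dg].
Qed.

Lemma smoothD V W (f g : R * R -> V) : open W ->
  smooth W f -> smooth W g -> smooth W (fun p => f p + g p).
Proof. by move=> oW sf sg k; exact: of_classD. Qed.

Lemma smooth_cst V W (a : V) : smooth W (fun=> a).
Proof.
move=> k; elim: k a => [|k IH] a /=; first by move=> p _; exact: cst_continuous.
split; first by move=> p _; exact: differentiable_cst.
- have -> : (fun p : R * R => 'D_(e_u R) (fun=> a) p) = (fun=> 0).
    by apply/funext => p; exact: derive_cst.
  exact: IH.
- have -> : (fun p : R * R => 'D_(e_v R) (fun=> a) p) = (fun=> 0).
    by apply/funext => p; exact: derive_cst.
  exact: IH.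
Qed.

Section Bilinear.
Variables (V1 V2 V3 : normedModType R) (B : {bilinear V1 -> V2 -> V3}).
Hypothesis contB : continuous (fun q : V1 * V2 => B q.1 q.2).

(** One product rule, applied below both to scaling and to [qf]. *)
Lemma bilinear_derive f g (p w : R * R) :
  differentiable f p -> differentiable g p ->
  differentiable (fun q => B (f q) (g q)) p /\
  'D_w (fun q => B (f q) (g q)) p = B ('D_w f p) (g p) + B (f p) ('D_w g p).
Proof.
move=> df dg.
have dfg : differentiable (fun q => (f q, g q)) p by exact: differentiable_pair.
have dB : differentiable (fun q => B q.1 q.2) (f p, g p).
  exact: differentiable_bilin.
have dBfg : differentiable ((fun q => B q.1 q.2) \o (fun q => (f q, g q))) p.
  exact: differentiable_comp.
split; first exact: dBfg.
rewrite deriveE; last exact: dBfg.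
rewrite [X in X w = _](diff_comp dfg dB) /= diff_bilin// diff_pair//= addrC.
by rewrite !deriveE.
Qed.

Lemma of_class_bilinear W k f g : open W ->
  of_class k W f -> of_class k W g -> of_class k W (fun p => B (f p) (g p)).
Proof.
move=> oW; elim: k f g => [|k IH] f g.
  move=> cf cg p Wp.
  apply: (@continuous_comp _ _ _ (fun q => (f q, g q)) (fun q => B q.1 q.2)).
    exact: (cvg_pair (cf p Wp) (cg p Wp)).
  exact: contB.
move=> Cf Cg; have [df duf dvf] := Cf; have [dg dug dvg] := Cg.
have cf := of_classS Cf; have cg := of_classS Cg.
split=> [p Wp||].
- by have [] := bilinear_derive (e_u R) (df p Wp) (dg p Wp).
- apply: (of_class_ext oW _ (of_classD oW (IH _ _ duf cg) (IH _ _ cf dug))).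
  by move=> p Wp; have [_ ->] := bilinear_derive (e_u R) (df p Wp) (dg p Wp).
- apply: (of_class_ext oW _ (of_classD oW (IH _ _ dvf cg) (IH _ _ cf dvg))).
  by move=> p Wp; have [_ ->] := bilinear_derive (e_v R) (df p Wp) (dg p Wp).
Qed.

End Bilinear.

Section Scale.
Variable V : normedModType R.

Let scale (a : R) (x : V) := a *: x.

Let scale_is_bilinear :
  bilinear_for (GRing.Scale.Law.clone _ _ *:%R _) (GRing.Scale.Law.clone _ _ *:%R _)
    scale.
Proof.
split=> [x|a] b c d /=; rewrite /scale; first by rewrite scalerDl scalerA.
by rewrite scalerDr !scalerA mulrC.
Qed.

HB.instance Definition _ :=
  bilinear_isBilinear.Build R R V V _ _ scale scale_is_bilinear.

Let scale_cont : continuous (fun q : R * V => scale q.1 q.2).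
Proof. exact: scale_continuous. Qed.

Lemma scale_derive (f : R * R -> R) (g : R * R -> V) p w :
  differentiable f p -> differentiable g p ->
  differentiable (fun q => f q *: g q) p /\
  'D_w (fun q => f q *: g q) p = 'D_w f p *: g p + f p *: 'D_w g p.
Proof. exact: (bilinear_derive scale_cont). Qed.

Lemma of_classZ W k (f : R * R -> R) (g : R * R -> V) : open W ->
  of_class k W f -> of_class k W g -> of_class k W (fun p => f p *: g p).
Proof. exact: (of_class_bilinear scale_cont). Qed.

Lemma smoothZ W (f : R * R -> R) (g : R * R -> V) : open W ->
  smooth W f -> smooth W g -> smooth W (fun p => f p *: g p).
Proof. by move=> oW sf sg k; exact: of_classZ. Qed.

End Scale.

Lemma smoothN V W (f : R * R -> V) : open W ->
  smooth W f -> smooth W (fun p => - f p).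
Proof.
move=> oW sf; apply: (smooth_ext oW _ (smoothZ oW (smooth_cst W (-1 : R)) sf)).
by move=> p _; rewrite scaleN1r.
Qed.

Lemma smoothV W (f : R * R -> R) : open W -> (forall p, W p -> f p != 0) ->
  smooth W f -> smooth W (fun p => (f p)^-1).
Proof.
move=> oW f0 sf; suff H k : of_class k W (fun p => (f p)^-1) by [].
elim: k => [|k IH].
  by move=> p Wp; apply: continuousV; [exact: f0|exact: (sf 0%N)].
(* The derivative of 1/f is a product of 1/f, 1/f and -f', so the induction on the order closes with
   [of_classZ]. *)
have dfV w p : W p ->
    ((f p)^-1 *: (f p)^-1) *: (-1 *: 'D_w f p) = 'D_w (fun q => (f q)^-1) p.
  move=> Wp; rewrite deriveV ?f0//; last exact: smooth_derivable sf Wp.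
  by rewrite expr2 invfM scaleN1r scalerN scaleNr.
split=> [p Wp||].
- by apply: differentiableV; [exact: smooth_differentiable sf Wp|exact: f0].
- apply: (of_class_ext oW (dfV _)); apply: of_classZ => //; first exact: of_classZ.
  by apply: of_classZ => //; [exact: smooth_cst|exact: smooth_Du].
- apply: (of_class_ext oW (dfV _)); apply: of_classZ => //; first exact: of_classZ.
  by apply: of_classZ => //; [exact: smooth_cst|exact: smooth_Dv].
Qed.

Lemma smoothM W (f g : R * R -> R) : open W ->
  smooth W f -> smooth W g -> smooth W (fun p => f p * g p).
Proof. exact: smoothZ. Qed.

Lemma smoothB V W (f g : R * R -> V) : open W ->
  smooth W f -> smooth W g -> smooth W (fun p => f p - g p).
Proof. by move=> oW sf sg; apply: smoothD => //; exact: smoothN. Qed.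

End Smooth.

(** * Symmetry of second derivatives *)

Section MixedPartials.
Variable R : realType.

Lemma is_derive_line (V : normedModType R) (f : V -> R) (a w : V) (t : R) :
  differentiable f (a + t *: w) ->
  is_derive t 1 (fun h : R => f (a + h *: w)) ('D_w f (a + t *: w)).
Proof.
move=> df; have dfw := @diff_derivable _ _ _ f (a + t *: w) w df.
have E : (fun h : R => h^-1 *: (((fun h => f (a + h *: w)) \o shift t) (h *: 1)
            - f (a + t *: w))) =
         (fun h => h^-1 *: ((f \o shift (a + t *: w)) (h *: w) - f (a + t *: w))).
  apply/funext => h /=; congr (_ *: (f _ - _)).
  by rewrite (_ : h *: 1 = h) ?scalerDl 1?addrCA//; exact: mulr1.
by apply: DeriveDef; rewrite /derivable /derive E.
Qed.

Lemma line_mvt (V : normedModType R) (f : V -> R) (a w : V) (s : R) : 0 < s ->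
  (forall t, 0 <= t <= s -> differentiable f (a + t *: w)) ->
  exists2 t, 0 < t < s & f (a + s *: w) - f a = s * 'D_w f (a + t *: w).
Proof.
move=> s0 df.
have dfl t : 0 <= t <= s ->
    is_derive t 1 (fun h : R => f (a + h *: w)) ('D_w f (a + t *: w)).
  by move=> /df; exact: is_derive_line.
have [||t] := MVT s0 (f := fun h => f (a + h *: w)) (df := fun t => 'D_w f (a + t *: w)).
- by move=> t; rewrite in_itv/= => /andP[? ?]; apply: dfl; rewrite !ltW.
- apply: continuous_in_subspaceT => t; rewrite inE/= in_itv/= => ts.
  by have [? _] := dfl t ts; apply: differentiable_continuous; exact/derivable1_diffP.
rewrite in_itv/= => ts; rewrite scale0r addr0 subr0 mulrC => E.
by exists t.
Qed.

(** The mean value theorem is used along [w1] for the increment of [f] by [s *: w2], then along [w2]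
    for the [w1]-derivative of [f]. The second difference on the left is symmetric in [w1] and [w2],
    so it also computes the derivative in the other order. *)
Lemma square_mvt (V : normedModType R) (f : V -> R) (p w1 w2 : V) (s : R) :
  0 < s ->
  (forall a b, 0 <= a <= s -> 0 <= b <= s ->
    differentiable f (p + a *: w1 + b *: w2) /\
    differentiable (fun q => 'D_w1 f q) (p + a *: w1 + b *: w2)) ->
  exists a b, [/\ 0 < a < s, 0 < b < s &
    f (p + s *: w1 + s *: w2) - f (p + s *: w1) - f (p + s *: w2) + f p =
    s ^+ 2 * 'D_w2 (fun q => 'D_w1 f q) (p + a *: w1 + b *: w2)].
Proof.
move=> s0 H; pose g q := f (q + s *: w2) - f q.
have s01 : 0 <= s <= s by rewrite lexx ltW.
have s00 : 0 <= (0 : R) <= s by rewrite lexx ltW.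
have dg a : 0 <= a <= s -> differentiable g (p + a *: w1) /\
    'D_w1 g (p + a *: w1) = 'D_w1 f (p + a *: w1 + s *: w2) - 'D_w1 f (p + a *: w1).
  move=> as0; have [d1 _] := H a s as0 s01.
  have [d0 _] := H a 0 as0 s00; rewrite scale0r addr0 in d0.
  have dsh : differentiable (fun q : V => q + s *: w2) (p + a *: w1) by [].
  have d1' : differentiable (fun q => f (q + s *: w2)) (p + a *: w1).
    exact: (differentiable_comp dsh d1).
  split; first exact: differentiableB.
  rewrite deriveB; [|exact: diff_derivable..]; congr (_ - _).
  rewrite !deriveE// [X in X w1 = _](diff_comp dsh d1)/=; congr ('d f _ _).
  by rewrite -deriveE// deriveD// derive_id derive_cst addr0.
have [a as0 Ea] := line_mvt s0 (fun t ts => (dg t ts).1).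
have as1 : 0 <= a <= s by case/andP: as0 => ? ?; rewrite !ltW.
have [b bs0 Eb] := line_mvt s0 (fun t ts => (H a t as1 ts).2).
exists a, b; split=> //; rewrite expr2 -mulrA -Eb -(dg a as1).2 -Ea /g; ring.
Qed.

(** If the two values differed at [p], let [e] be half their distance. On a small square the second
    difference represents both mixed derivatives, each at some point of the square, and continuity
    puts the common value within [e] of both. *)
Lemma mixed_partials (W : set (R * R)) (f : R * R -> R) p :
  open W -> smooth W f -> W p ->
  'D_(e_u R) (fun q => 'D_(e_v R) f q) p = 'D_(e_v R) (fun q => 'D_(e_u R) f q) p.
Proof.
move=> oW sf Wp; set g := fun q => _; set h := fun q => 'D__ f q.
have cg := smooth_Du (smooth_Dv sf) 0%N _ Wp.
have ch := smooth_Dv (smooth_Du sf) 0%N _ Wp.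
apply/eqP; apply: contraT => neq.
pose e := `|'D_(e_u R) g p - 'D_(e_v R) h p| / 2.
have e0 : 0 < e by rewrite divr_gt0// normr_gt0 subr_eq0.
have Ng : \forall q \near p, `|'D_(e_u R) g p - 'D_(e_u R) g q| < e.
  exact: (cvgrPdist_lt _ _).1 cg _ e0.
have Nh : \forall q \near p, `|'D_(e_v R) h p - 'D_(e_v R) h q| < e.
  exact: (cvgrPdist_lt _ _).1 ch _ e0.
have NW : \forall q \near p, W q by exact: open_near oW Wp _.
have [d /= d0 B] : nbhs_ball p (fun q => [/\ W q,
    `|'D_(e_u R) g p - 'D_(e_u R) g q| < e & `|'D_(e_v R) h p - 'D_(e_v R) h q| < e]).
  by apply/nbhs_ballP; move: NW Ng Nh; apply: filterS3.
(* The closed square of side d / 2 stays inside the open ball of radius d for the maximum norm. *)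
have dd : d / 2 < d by rewrite ltr_pdivrMr// ltr_pMr// ltr1n.
have {}B a b : 0 <= a <= d / 2 -> 0 <= b <= d / 2 ->
    let q := p + a *: e_u R + b *: e_v R in [/\ W q,
    `|'D_(e_u R) g p - 'D_(e_u R) g q| < e & `|'D_(e_v R) h p - 'D_(e_v R) h q| < e].
  move=> /andP[a0 ad] /andP[b0 bd]; apply: B.
  rewrite -ball_normE /= -addrA opprD addNKr normrN prod_normE gt_max /=.
  rewrite /GRing.scale/= !(mulr0, mulr1, add0r, addr0) !ger0_norm//.
  by rewrite (le_lt_trans ad dd) (le_lt_trans bd dd).
have d20 : 0 < d / 2 by rewrite divr_gt0.
have [a [b [as0 bs0 E1]]] :=
  @square_mvt _ f p (e_u R) (e_v R) (d / 2) d20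
    (fun a b ha hb => let: And3 Wq _ _ := B a b ha hb in
      conj (smooth_differentiable sf Wq) (smooth_differentiable (smooth_Du sf) Wq)).
have swap x y : p + x *: e_v R + y *: e_u R = p + y *: e_u R + x *: e_v R.
  by rewrite addrAC.
have [b' [a' [bs1 as1]]] :
  exists a b, [/\ 0 < a < d / 2, 0 < b < d / 2 & 
    f (p + (d / 2) *: e_v R + (d / 2) *: e_u R) - f (p + (d / 2) *: e_v R)
      - f (p + (d / 2) *: e_u R) + f p =
    (d / 2) ^+ 2 * 'D_(e_u R) g (p + a *: e_v R + b *: e_u R)].
  apply: square_mvt => // x y xs ys; rewrite swap; have [Wq _ _] := B y x ys xs.
  split; first exact: smooth_differentiable sf Wq.
  exact: smooth_differentiable (smooth_Dv sf) Wq.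
rewrite !swap => E2.
have E : 'D_(e_u R) g (p + a' *: e_u R + b' *: e_v R) =
         'D_(e_v R) h (p + a *: e_u R + b *: e_v R).
  apply: (@mulfI _ ((d / 2) ^+ 2)); first by rewrite expf_neq0// gt_eqF.
  by apply: etrans (esym E2) _; apply: etrans _ E1; congr (_ + _); exact: addrAC.
have wk x : 0 < x < d / 2 -> 0 <= x <= d / 2 by move=> /andP[? ?]; rewrite !ltW.
have [_ G _] := B a' b' (wk _ as1) (wk _ bs1).
have [_ _ H] := B a b (wk _ as0) (wk _ bs0).
have mid (x y z : R) : `|x - z| < e -> `|y - z| < e -> `|x - y| < e + e.
  move=> xz yz; apply: le_lt_trans (ltrD xz yz); rewrite (distrC y).
  exact: ler_distD.
rewrite E in G; have := mid _ _ _ G H.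
by rewrite -splitr ltxx.
Qed.

End MixedPartials.

(** * The quadratic form and its frames *)

Section QuadraticForm.
Variable K : comPzRingType.
Implicit Types x y z : 'rV[K]_6.

Lemma qfC x y : qf x y = qf y x.
Proof. by congr (_ - _); apply: eq_bigr => i _; rewrite mulrC. Qed.

Lemma qfDl x y z : qf (x + y) z = qf x z + qf y z.
Proof.
rewrite /qf addrACA -opprD -!big_split /=.
by congr (_ - _); apply: eq_bigr => i _; rewrite mxE mulrDl.
Qed.

Lemma qfZl a x y : qf (a *: x) y = a * qf x y.
Proof.
rewrite /qf mulrBr !mulr_sumr.
by congr (_ - _); apply: eq_bigr => i _; rewrite mxE mulrA.
Qed.

Lemma qfDr x y z : qf x (y + z) = qf x y + qf x z.
Proof. by rewrite !(qfC x) qfDl. Qed.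

Lemma qfZr a x y : qf x (a *: y) = a * qf x y.
Proof. by rewrite !(qfC x) qfZl. Qed.

Lemma qfNl x y : qf (- x) y = - qf x y.
Proof. by rewrite -scaleN1r qfZl mulN1r. Qed.

Lemma qfNr x y : qf x (- y) = - qf x y.
Proof. by rewrite !(qfC x) qfNl. Qed.

Lemma qf0l x : qf 0 x = 0.
Proof. by rewrite -(scale0r x) qfZl mul0r. Qed.

Lemma qf0r x : qf x 0 = 0.
Proof. by rewrite qfC qf0l. Qed.

Definition qfE := (qfDl, qfDr, qfNl, qfNr, qfZl, qfZr, qf0l, qf0r).

Lemma qf_delta x (i : 'I_6) :
  qf x (delta_mx 0 i) = if (i < 4)%N then x 0 i else - x 0 i.
Proof.
have E (P : pred 'I_6) : \sum_(j < 6 | P j) x 0 j * (delta_mx 0 i : 'rV[K]_6) 0 j =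
    if P i then x 0 i else 0.
  case: ifP => Pi; last first.
    rewrite big1// => j Pj; have /negPf ji : j != i.
      by apply: contraTneq Pj => ->; rewrite Pi.
    by rewrite mxE ji mulr0.
  rewrite (bigD1 i)//= mxE !eqxx mulr1 big1 ?addr0// => j /andP[_ /negPf ji].
  by rewrite mxE ji mulr0.
by rewrite /qf !E; case: ltnP => _; rewrite ?subr0 ?sub0r.
Qed.

Lemma qf_nondegenerate x y : (forall z, qf x z = qf y z) -> x = y.
Proof.
move=> xy; apply/rowP => i; have := xy (delta_mx 0 i); rewrite !qf_delta.
by case: ifP => // _ /oppr_inj.
Qed.

End QuadraticForm.

Section QuadraticCalculus.
Variable R : realType.
Implicit Types (W : set (R * R)) (f g : R * R -> 'rV[R]_6).

Let q (x y : 'rV[R]_6) : R := qf x y.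

Let q_bilinear :
  bilinear_for (GRing.Scale.Law.clone _ _ *:%R _) (GRing.Scale.Law.clone _ _ *:%R _) q.
Proof. by split=> [y|x] a b c /=; rewrite /q !qfE. Qed.

HB.instance Definition _ :=
  bilinear_isBilinear.Build R 'rV[R]_6 'rV[R]_6 R _ _ q q_bilinear.

Let q_cont : continuous (fun p : 'rV[R]_6 * 'rV[R]_6 => q p.1 p.2).
Proof.
have cp (i : 'I_6) : continuous (fun p : 'rV[R]_6 * 'rV[R]_6 => p.1 0 i * p.2 0 i).
  move=> p; apply: continuousM.
    by apply: (@continuous_comp _ _ _ fst (fun x : 'rV[R]_6 => x 0 i));
      [exact: cvg_fst|exact: coord_continuous].
  by apply: (@continuous_comp _ _ _ snd (fun x : 'rV[R]_6 => x 0 i));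
    [exact: cvg_snd|exact: coord_continuous].
have cs (P : pred 'I_6) : continuous (fun p : 'rV[R]_6 * 'rV[R]_6 =>
    \sum_(i < 6 | P i) p.1 0 i * p.2 0 i).
  by apply: continuous_big => [|i _]; [exact: add_continuous|exact: cp].
by move=> p; apply: continuousB; exact: cs.
Qed.

Lemma qf_derive f g p w : differentiable f p -> differentiable g p ->
  'D_w (fun x => qf (f x) (g x)) p = qf ('D_w f p) (g p) + qf (f p) ('D_w g p).
Proof. by move=> df dg; have [] := bilinear_derive q_cont w df dg. Qed.

Lemma differentiable_qf f g p : differentiable f p -> differentiable g p ->
  differentiable (fun x => qf (f x) (g x)) p.
Proof. by move=> df dg; have [] := bilinear_derive q_cont 0 df dg. Qed.

Lemma smooth_qf W f g : open W -> smooth W f -> smooth W g ->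
  smooth W (fun p => qf (f p) (g p)).
Proof. by move=> oW sf sg k; exact: (of_class_bilinear q_cont). Qed.

(** Pairing with a constant vector [z] reduces to scalar functions, and nondegeneracy of [qf]
    recovers the vectors. *)
Lemma mixed_partials_row W f p : open W -> smooth W f -> W p ->
  'D_(e_u R) (fun q => 'D_(e_v R) f q) p = 'D_(e_v R) (fun q => 'D_(e_u R) f q) p.
Proof.
move=> oW sf Wp; apply: qf_nondegenerate => z.
have sz : smooth W (fun=> z) by exact: smooth_cst.
have D1 w x : W x -> 'D_w (fun q => qf (f q) z) x = qf ('D_w f x) z.
  move=> Wx; rewrite qf_derive ?derive_cst ?qf0r ?addr0//.
  exact: smooth_differentiable sf Wx.
have D2 w w' : smooth W (fun q => 'D_w f q) ->
    'D_w' (fun x => 'D_w (fun q => qf (f q) z) x) p = qf ('D_w' (fun q => 'D_w f q) p) z.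
  move=> sDf; rewrite (eq_on_derive w' oW (D1 w))// qf_derive ?derive_cst ?qf0r ?addr0//.
  exact: smooth_differentiable sDf Wp.
apply: etrans (D2 _ _ (smooth_Du sf)); apply: etrans (esym (D2 _ _ (smooth_Dv sf))) _.
exact: mixed_partials oW (smooth_qf oW sf sz) Wp.
Qed.

End QuadraticCalculus.

Section Frames.
Variable R : realType.
Implicit Types (x y z Y U V N S L : 'rV[R]_6) (b : seq 'rV[R]_6) (o : bool).

Definition rows b : 'M[R]_6 := \matrix_(i < 6) nth 0 b i.

Lemma rows_tperm b b' (i j : 'I_6) : i != j ->
  (forall k : 'I_6, nth 0 b' k = nth 0 b (tperm i j k)) -> \det (rows b') = - \det (rows b).
Proof.
move=> ij bb'; have -> : rows b' = xrow i j (rows b).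
  by apply/matrixP => k l; rewrite !mxE bb'.
by rewrite /xrow row_permE det_mulmx det_perm odd_tperm ij expr1 mulN1r.
Qed.

Ltac ord6 := case; do 6?[case=> //=].

(** The change of basis is a lower triangular matrix with diagonal [d], so only [d] enters the
    determinant. *)
Lemma det_rows_trig b b' (d : seq R) (c : 'I_6 -> 'I_6 -> R) :
  (forall i : 'I_6, nth 0 b' i = d`_i *: nth 0 b i +
     \sum_(j < 6 | (j < i)%N) c i j *: nth 0 b j) ->
  \det (rows b') = \prod_(i < 6) d`_i * \det (rows b).
Proof.
move=> H; pose T : 'M[R]_6 := \matrix_(i, j)
  if (j < i)%N then c i j else if i == j then d`_i else 0.
have -> : rows b' = T *m rows b.
  apply/row_matrixP => i; rewrite row_mul mulmx_sum_row rowK H.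
  rewrite [RHS](bigID (fun j : 'I_6 => (j < i)%N)) /= [RHS]addrC; congr (_ + _); last first.
    by apply: eq_bigr => j ji; rewrite !mxE ji rowK.
  rewrite (bigD1 i) ?ltnn//= !mxE ltnn eqxx rowK big1 ?addr0// => j /andP[/negPf ji jni].
  by rewrite !mxE ji eq_sym (negPf jni) scale0r.
rewrite det_mulmx det_trig; last first.
  by apply/is_trig_mxP => i j ij; rewrite mxE ltnNge (ltnW ij)/= -val_eqE ltn_eqF.
by congr (_ * _); apply: eq_bigr => i _; rewrite mxE ltnn eqxx.
Qed.

(** [S] stands for the right null normal, the letter R being taken by the field, and [L] for the
    left one. *)
Record frame o Y U V N S L : Prop := Frame {
  frYY : qf Y Y = 0; frYU : qf Y U = 0; frYV : qf Y V = 0; frYN : qf Y N = -1;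
  frYS : qf Y S = 0; frYL : qf Y L = 0; frUU : qf U U = 1; frUV : qf U V = 0;
  frUN : qf U N = 0; frUS : qf U S = 0; frUL : qf U L = 0; frVV : qf V V = 1;
  frVN : qf V N = 0; frVS : qf V S = 0; frVL : qf V L = 0; frNN : qf N N = 0;
  frNS : qf N S = 0; frNL : qf N L = 0; frSS : qf S S = 0; frSL : qf S L = -1;
  frLL : qf L L = 0;
  fr_oriented : positively_oriented o [:: Y; U; V; N; S; L] }.

Section FrameTheory.
Variables (o : bool) (Y U V N S L : 'rV[R]_6).
Hypothesis F : frame o Y U V N S L.

Definition frE := ((frYY F, frYU F, frYV F, frYN F, frYS F, frYL F),
  (frUU F, frUV F, frUN F, frUS F, frUL F, qfC U Y),
  (frVV F, frVN F, frVS F, frVL F, qfC V Y, qfC V U),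
  (frNN F, frNS F, frNL F, qfC N Y, qfC N U, qfC N V),
  (frSS F, frSL F, qfC S Y, qfC S U, qfC S V, qfC S N),
  (frLL F, qfC L Y, qfC L U, qfC L V, qfC L N, qfC L S)).

(** The orientation makes the determinant nonzero, so the six vectors form a basis and equality of
    the pairings extends to every [z]. *)
Lemma frame_eq x y :
  qf x Y = qf y Y -> qf x U = qf y U -> qf x V = qf y V ->
  qf x N = qf y N -> qf x S = qf y S -> qf x L = qf y L -> x = y.
Proof.
move=> hY hU hV hN hS hL; apply: qf_nondegenerate => z.
have uB : rows [:: Y; U; V; N; S; L] \in unitmx.
  rewrite unitmxE unitfE; apply/negP => /eqP d0; have := fr_oriented F.
  by rewrite /positively_oriented -/(rows _) d0 mulr0 ltxx.
rewrite -[z](mulmxKV uB) mulmx_sum_row; set c := z *m _.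
by rewrite !big_ord_recl big_ord0 !rowK /= !qfE hY hU hV hN hS hL.
Qed.

(** The Gram matrix is its own inverse, so the coefficient of a vector is, up to sign, the pairing
    with its partner. *)
Lemma frame_decomp x : x = - qf x N *: Y + qf x U *: U + qf x V *: V - qf x Y *: N
  - qf x L *: S - qf x S *: L.
Proof. by apply: frame_eq; rewrite !qfE !frE; ring. Qed.

End FrameTheory.

Lemma oriented_det o b b' : \det (rows b') = \det (rows b) ->
  positively_oriented o b -> positively_oriented o b'.
Proof. by rewrite /positively_oriented -!/(rows _) => ->. Qed.

Lemma oriented_scale o Y U V N S L (d : R) : d != 0 ->
  positively_oriented o [:: Y; U; V; N; S; L] ->
  positively_oriented o [:: Y; U; V; N; d^-1 *: S; d *: L].
Proof.
move=> d0; apply: oriented_det.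
rewrite (@det_rows_trig [:: Y; U; V; N; S; L] _ [:: 1; 1; 1; 1; d^-1; d] (fun _ _ => 0)).
  by rewrite !big_ord_recl big_ord0 /= !mul1r mulr1 mulVf// mul1r.
by ord6 => i; rewrite big1 ?addr0 ?scale1r// => *; rewrite scale0r.
Qed.

Lemma oriented_swap o Y U V N S L :
  positively_oriented o [:: Y; U; V; N; S; L] ->
  positively_oriented (~~ o) [:: Y; U; V; N; L; S].
Proof.
rewrite /positively_oriented -!/(rows _).
rewrite (@rows_tperm [:: Y; U; V; N; L; S] [:: Y; U; V; N; S; L] (inord 4) (inord 5)).
- by case: o; rewrite /= !(expr0, expr1, mulNr, mulrN, opprK, mul1r).
- by rewrite -val_eqE /= !inordK.
- by ord6 => i; rewrite permE /= -!val_eqE /= !inordK//= ?inordK.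
Qed.

(** The factors contribute m^4 x y = 1, so the sign is that of the transposition of [S] and [L].
    This is what separates the left polar from the right one. *)
Lemma oriented_exchange o Y U V N S L (m x y : R) : m ^+ 2 = 1 -> x * y = 1 ->
  positively_oriented o [:: Y; U; V; N; S; L] ->
  ~ positively_oriented o [:: m *: Y; m *: U; m *: V; m *: N; x *: L; y *: S].
Proof.
move=> m1 xy; rewrite /positively_oriented -!/(rows _).
rewrite (@det_rows_trig [:: Y; U; V; N; L; S]
  [:: m *: Y; m *: U; m *: V; m *: N; x *: L; y *: S] [:: m; m; m; m; x; y] (fun _ _ => 0)).
  rewrite (@rows_tperm [:: Y; U; V; N; S; L] [:: Y; U; V; N; L; S] (inord 4) (inord 5)).
  - rewrite !big_ord_recl big_ord0 /= (_ : m * _ = 1).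
      by rewrite mul1r mulrN oppr_gt0 => /ltW /le_gtF ->.
    by transitivity (m ^+ 2 ^+ 2 * (x * y)); [ring|rewrite m1 xy expr1n mulr1].
  - by rewrite -val_eqE /= !inordK.
  - by ord6 => i; rewrite permE /= -!val_eqE /= !inordK//= ?inordK.
by ord6 => i; rewrite big1 ?addr0// => *; rewrite scale0r.
Qed.

(* The passage from the frame of [Y] to that of its polar [L] is, up to reordering,
   unitriangular except for the entry -1 coming from V. *)
Lemma oriented_polar o Y U V N S L (a b x1 x2 n1 n2 : R) :
  positively_oriented o [:: Y; U; V; N; S; L] ->
  positively_oriented o [:: L; a *: L + U + a *: Y; b *: L - V - b *: Y;
    S + n1 *: Y + a *: U - b *: V + n2 *: L; Y;
    N + x1 *: Y + a *: U + b *: V + x2 *: L].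
Proof.
apply: oriented_det; set U' := _ + a *: Y; set V' := _ - b *: Y.
set N' := _ + n2 *: L; set X := _ + x2 *: L.
have T i j : (i < 6)%N -> (j < 6)%N -> i != j ->
    (inord i : 'I_6) != inord j by move=> i6 j6 ij; rewrite -val_eqE /= !inordK.
rewrite (@rows_tperm [:: L; U'; V'; X; Y; N'] _ (inord 3) (inord 5)); last 2 first.
- exact: T.
- by ord6 => i; rewrite permE /= -!val_eqE /= !inordK//= ?inordK.
rewrite (@rows_tperm [:: L; U'; V'; Y; X; N'] _ (inord 3) (inord 4)); last 2 first.
- exact: T.
- by ord6 => i; rewrite permE /= -!val_eqE /= !inordK//= ?inordK.
rewrite (@rows_tperm [:: Y; U'; V'; L; X; N'] _ (inord 0) (inord 3)); last 2 first.
- exact: T.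
- by ord6 => i; rewrite permE /= -!val_eqE /= !inordK//= ?inordK.
rewrite (@rows_tperm [:: Y; L; V'; U'; X; N'] _ (inord 1) (inord 3)); last 2 first.
- exact: T.
- by ord6 => i; rewrite permE /= -!val_eqE /= !inordK//= ?inordK.
rewrite (@rows_tperm [:: Y; L; V; N; S; U] [:: Y; U; V; N; S; L] (inord 1) (inord 5));
  last 2 first.
- exact: T.
- by ord6 => i; rewrite permE /= -!val_eqE /= !inordK//= ?inordK.
rewrite (@rows_tperm [:: Y; L; V; U; S; N] [:: Y; L; V; N; S; U] (inord 3) (inord 5));
  last 2 first.
- exact: T.
- by ord6 => i; rewrite permE /= -!val_eqE /= !inordK//= ?inordK.
rewrite (@rows_tperm [:: Y; L; V; U; N; S] [:: Y; L; V; U; S; N] (inord 4) (inord 5));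
  last 2 first.
- exact: T.
- by ord6 => i; rewrite permE /= -!val_eqE /= !inordK//= ?inordK.
(* Seven transpositions have been made, four on the new frame and three on the old one; their sign
   is cancelled by the diagonal entry -1. *)
pose C := [:: [::]; [::]; [:: - b; b]; [:: a; a]; [:: x1; x2; b; a];
  [:: n1; n2; - b; a; 0]] : seq (seq R).
rewrite (@det_rows_trig [:: Y; L; V; U; N; S] [:: Y; L; V'; U'; X; N'] [:: 1; 1; -1; 1; 1; 1]
  (fun i j => (nth [::] C i)`_j)).
  by rewrite !big_ord_recl big_ord0 /=; ring.
ord6 => i; rewrite big_mkcond !big_ord_recl big_ord0 /= ?scale1r ?addr0 ?add0r//;
  by apply/rowP => k; rewrite !mxE; ring.
Qed.

End Frames.

(** * Complex derivatives in real terms *)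

(* Sealing the partial derivatives prevents unification from unfolding limits. *)
HB.lock Definition du (R : realType) (V : normedModType R) (f : R * R -> V) p :=
  'D_(e_u R) f p.
HB.lock Definition dv (R : realType) (V : normedModType R) (f : R * R -> V) p :=
  'D_(e_v R) f p.

Section Partials.
Variables (R : realType) (W : set (R * R)) (oW : open W).
Implicit Type V : normedModType R.

Lemma duE V (f : R * R -> V) p : 'D_(e_u R) f p = du f p.
Proof. by rewrite du.unlock. Qed.

Lemma dvE V (f : R * R -> V) p : 'D_(e_v R) f p = dv f p.
Proof. by rewrite dv.unlock. Qed.

Lemma smooth_du V (f : R * R -> V) : smooth W f -> smooth W (du f).
Proof. by rewrite du.unlock; exact: smooth_Du. Qed.

Lemma smooth_dv V (f : R * R -> V) : smooth W f -> smooth W (dv f).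
Proof. by rewrite dv.unlock; exact: smooth_Dv. Qed.

Lemma du_ext V (f g : R * R -> V) p :
  (forall q, W q -> f q = g q) -> W p -> du f p = du g p.
Proof. by rewrite du.unlock; exact: eq_on_derive. Qed.

Lemma dv_ext V (f g : R * R -> V) p :
  (forall q, W q -> f q = g q) -> W p -> dv f p = dv g p.
Proof. by rewrite dv.unlock; exact: eq_on_derive. Qed.

Lemma du_cst V (a : V) p : du (fun=> a) p = 0.
Proof. by rewrite du.unlock derive_cst. Qed.

Lemma dv_cst V (a : V) p : dv (fun=> a) p = 0.
Proof. by rewrite dv.unlock derive_cst. Qed.

Section Rules.
Variables (V : normedModType R) (p : R * R) (Wp : W p).

Lemma duD (f g : R * R -> V) : smooth W f -> smooth W g ->
  du (fun q => f q + g q) p = du f p + du g p.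
Proof. by move=> sf sg; rewrite du.unlock deriveD//; exact: smooth_derivable Wp. Qed.

Lemma dvD (f g : R * R -> V) : smooth W f -> smooth W g ->
  dv (fun q => f q + g q) p = dv f p + dv g p.
Proof. by move=> sf sg; rewrite dv.unlock deriveD//; exact: smooth_derivable Wp. Qed.

Lemma duN (f : R * R -> V) : smooth W f -> du (fun q => - f q) p = - du f p.
Proof. by move=> sf; rewrite du.unlock deriveN//; exact: smooth_derivable Wp. Qed.

Lemma dvN (f : R * R -> V) : smooth W f -> dv (fun q => - f q) p = - dv f p.
Proof. by move=> sf; rewrite dv.unlock deriveN//; exact: smooth_derivable Wp. Qed.

Lemma duZ (a : R * R -> R) (f : R * R -> V) : smooth W a -> smooth W f ->
  du (fun q => a q *: f q) p = du a p *: f p + a p *: du f p.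
Proof.
by move=> sa sf; rewrite du.unlock; apply: (scale_derive _ _ _).2;
  exact: smooth_differentiable Wp.
Qed.

Lemma dvZ (a : R * R -> R) (f : R * R -> V) : smooth W a -> smooth W f ->
  dv (fun q => a q *: f q) p = dv a p *: f p + a p *: dv f p.
Proof.
by move=> sa sf; rewrite dv.unlock; apply: (scale_derive _ _ _).2;
  exact: smooth_differentiable Wp.
Qed.

Lemma du_qf (f g : R * R -> 'rV[R]_6) : smooth W f -> smooth W g ->
  du (fun q => qf (f q) (g q)) p = qf (du f p) (g p) + qf (f p) (du g p).
Proof.
by move=> sf sg; rewrite du.unlock; apply: qf_derive; exact: smooth_differentiable Wp.
Qed.

Lemma dv_qf (f g : R * R -> 'rV[R]_6) : smooth W f -> smooth W g ->
  dv (fun q => qf (f q) (g q)) p = qf (dv f p) (g p) + qf (f p) (dv g p).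
Proof.
by move=> sf sg; rewrite dv.unlock; apply: qf_derive; exact: smooth_differentiable Wp.
Qed.

Lemma du_dv (f : R * R -> 'rV[R]_6) : smooth W f -> du (dv f) p = dv (du f) p.
Proof. by move=> sf; rewrite du.unlock dv.unlock; exact: mixed_partials_row Wp. Qed.

End Rules.
End Partials.

(** This is 4 Y_{z zbar}, a multiple of the fourth generator of V, sealed for the same reason as
    [du] and [dv]. *)
HB.lock Definition laplacian (R : realType) (Y : R * R -> 'rV[R]_6) p :=
  du (du Y) p + dv (dv Y) p.

Section Complexification.
Variable R : realType.
Implicit Types (x y : 'rV[R]_6) (X Z : 'rV[R[i]]_6) (c : R[i]).

Lemma eqCV X Z : reV X = reV Z -> imV X = imV Z -> X = Z.
Proof.
move=> /rowP re /rowP im; apply/rowP => i.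
by apply/eqP; rewrite eq_complex; have := re i; have := im i; rewrite !mxE => -> ->; rewrite !eqxx.
Qed.

Lemma reV_toC x : reV (toC x) = x.
Proof. by apply/rowP => i; rewrite !mxE. Qed.

Lemma imV_toC x : imV (toC x) = 0.
Proof. by apply/rowP => i; rewrite !mxE. Qed.

Lemma reVD X Z : reV (X + Z) = reV X + reV Z.
Proof. by apply/rowP => i; rewrite !mxE; case: (X _ _) (Z _ _) => ? ? []. Qed.

Lemma imVD X Z : imV (X + Z) = imV X + imV Z.
Proof. by apply/rowP => i; rewrite !mxE; case: (X _ _) (Z _ _) => ? ? []. Qed.

Lemma reVN X : reV (- X) = - reV X.
Proof. by apply/rowP => i; rewrite !mxE; case: (X _ _). Qed.

Lemma imVN X : imV (- X) = - imV X.
Proof. by apply/rowP => i; rewrite !mxE; case: (X _ _). Qed.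

Lemma reVZ c X : reV (c *: X) = complex.Re c *: reV X - complex.Im c *: imV X.
Proof. by apply/rowP => i; rewrite !mxE; case: (X _ _) c => ? ? []. Qed.

Lemma imVZ c X : imV (c *: X) = complex.Re c *: imV X + complex.Im c *: reV X.
Proof. by apply/rowP => i; rewrite !mxE; case: (X _ _) c => ? ? []. Qed.

Lemma reV_conj X : reV (conjV X) = reV X.
Proof. by apply/rowP => i; rewrite !mxE; case: (X _ _). Qed.

Lemma imV_conj X : imV (conjV X) = - imV X.
Proof. by apply/rowP => i; rewrite !mxE; case: (X _ _). Qed.

Lemma qf_toC x y : qf (toC x) (toC y) = (qf x y)%:C%C.
Proof.
have E (P : pred 'I_6) : \sum_(i < 6 | P i) toC x 0 i * toC y 0 i =
    (\sum_(i < 6 | P i) x 0 i * y 0 i)%:C%C.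
  by rewrite rmorph_sum; apply: eq_bigr => i _; rewrite !mxE rmorphM.
by rewrite /qf !E rmorphB.
Qed.

Lemma complex_half : (2^-1 : R[i]) = (2^-1)%:C%C.
Proof. by rewrite fmorphV rmorph_nat. Qed.

Lemma Re_real (a : R) : complex.Re a%:C%C = a. Proof. by []. Qed.
Lemma Im_real (a : R) : complex.Im a%:C%C = 0. Proof. by []. Qed.
Lemma Re_i : complex.Re ('i%C : R[i]) = 0. Proof. by []. Qed.
Lemma Im_i : complex.Im ('i%C : R[i]) = 1. Proof. by []. Qed.

Lemma ReN c : complex.Re (- c) = - complex.Re c. Proof. by case: c. Qed.
Lemma ImN c : complex.Im (- c) = - complex.Im c. Proof. by case: c. Qed.

Lemma Re_half c : complex.Re (c / 2) = complex.Re c / 2.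
Proof. by rewrite complex_half; case: c => x y /=; ring. Qed.
Lemma Im_half c : complex.Im (c / 2) = complex.Im c / 2.
Proof. by rewrite complex_half; case: c => x y /=; ring. Qed.

Definition vec_reimE := (reVD, imVD, reVN, imVN, reVZ, imVZ, reV_toC, imV_toC).
Definition cpx_reimE := (ReN, ImN, Re_half, Im_half).
Definition reimE := (vec_reimE, Re_real, Im_real, Re_i, Im_i, complex_half).

Implicit Types (Y : R * R -> 'rV[R]_6) (F : R * R -> 'rV[R[i]]_6).

Lemma reV_derivC w F p : reV (Defs.derivC w F p) = 'D_w (fun q => reV (F q)) p.
Proof. by rewrite /Defs.derivC !reimE !(scale0r, scaler0, subr0, addr0). Qed.

Lemma imV_derivC w F p : imV (Defs.derivC w F p) = 'D_w (fun q => imV (F q)) p.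
Proof. by rewrite /Defs.derivC !reimE !(scale0r, scaler0, scale1r, addr0, add0r). Qed.

Lemma reV_dz F p : reV (dz F p) =
  2^-1 *: (du (fun q => reV (F q)) p + dv (fun q => imV (F q)) p).
Proof.
rewrite /dz -!(duE, dvE) -!reV_derivC -!imV_derivC.
move: (Defs.derivC _ F p) (Defs.derivC _ F p) => A B.
by rewrite !reimE !(scale0r, scale1r, add0r, addr0, subr0, sub0r, scalerN, opprK).
Qed.

Lemma imV_dz F p : imV (dz F p) =
  2^-1 *: (du (fun q => imV (F q)) p - dv (fun q => reV (F q)) p).
Proof.
rewrite /dz -!(duE, dvE) -!reV_derivC -!imV_derivC.
move: (Defs.derivC _ F p) (Defs.derivC _ F p) => A B.
by rewrite !reimE !(scale0r, scale1r, add0r, addr0, subr0, sub0r, scalerN, opprK).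
Qed.

Lemma reV_dzbar F p : reV (dzbar F p) =
  2^-1 *: (du (fun q => reV (F q)) p - dv (fun q => imV (F q)) p).
Proof.
rewrite /dzbar -!(duE, dvE) -!reV_derivC -!imV_derivC.
move: (Defs.derivC _ F p) (Defs.derivC _ F p) => A B.
by rewrite !reimE !(scale0r, scale1r, add0r, addr0, subr0, sub0r, scalerN, opprK).
Qed.

Lemma imV_dzbar F p : imV (dzbar F p) =
  2^-1 *: (du (fun q => imV (F q)) p + dv (fun q => reV (F q)) p).
Proof.
rewrite /dzbar -!(duE, dvE) -!reV_derivC -!imV_derivC.
move: (Defs.derivC _ F p) (Defs.derivC _ F p) => A B.
by rewrite !reimE !(scale0r, scale1r, add0r, addr0, subr0, sub0r, scalerN, opprK).
Qed.

Lemma imV_toC_fun Y : (fun q => imV (toC (Y q))) = (fun=> 0).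
Proof. by apply/funext => q; rewrite imV_toC. Qed.

Lemma reV_toC_fun Y : (fun q => reV (toC (Y q))) = Y.
Proof. by apply/funext => q; rewrite reV_toC. Qed.

Lemma reV_Yz Y p : reV (Yz Y p) = 2^-1 *: du Y p.
Proof. by rewrite reV_dz reV_toC_fun imV_toC_fun ?du_cst ?dv_cst addr0. Qed.

Lemma imV_Yz Y p : imV (Yz Y p) = - 2^-1 *: dv Y p.
Proof. by rewrite imV_dz reV_toC_fun imV_toC_fun ?du_cst ?dv_cst sub0r scalerN scaleNr. Qed.

Lemma reV_Yzbar Y p : reV (Yzbar Y p) = 2^-1 *: du Y p.
Proof. by rewrite reV_dzbar reV_toC_fun imV_toC_fun ?du_cst ?dv_cst subr0. Qed.

Lemma imV_Yzbar Y p : imV (Yzbar Y p) = 2^-1 *: dv Y p.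
Proof. by rewrite imV_dzbar reV_toC_fun imV_toC_fun ?du_cst ?dv_cst add0r. Qed.

Lemma toC_reV_imV X : X = toC (reV X) + 'i%C *: toC (imV X).
Proof.
apply: eqCV; rewrite !reimE; first by rewrite !(scale0r, scaler0, subr0, addr0).
by rewrite !(scale0r, scaler0, scale1r, add0r).
Qed.

Lemma qf_complex X Z : qf X Z = ((qf (reV X) (reV Z) - qf (imV X) (imV Z))
  +i* (qf (reV X) (imV Z) + qf (imV X) (reV Z)))%C.
Proof.
rewrite {1}(toC_reV_imV X) {1}(toC_reV_imV Z) !qfE !qf_toC.
move: (qf _ _) (qf _ _) (qf _ _) (qf _ _) => a b c d.
by apply/eqP; rewrite eq_complex /=; apply/andP; split; apply/eqP; ring.
Qed.

Lemma qf_Yz Y p : qf (Yz Y p) (Yz Y p) =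
  (4^-1 * (qf (du Y p) (du Y p) - qf (dv Y p) (dv Y p))
   +i* (- 2^-1 * qf (du Y p) (dv Y p)))%C.
Proof.
rewrite qf_complex reV_Yz imV_Yz.
rewrite !qfE (qfC (dv Y p) (du Y p)).
by apply/eqP; rewrite eq_complex /=; apply/andP; split; apply/eqP; field.
Qed.

Lemma qf_Yz_Yzbar Y p : qf (Yz Y p) (Yzbar Y p) =
  (4^-1 * (qf (du Y p) (du Y p) + qf (dv Y p) (dv Y p)))%:C%C.
Proof.
rewrite qf_complex (reV_Yz Y p) (imV_Yz Y p) reV_Yzbar imV_Yzbar.
rewrite !qfE (qfC (dv Y p) (du Y p)).
by apply/eqP; rewrite eq_complex /=; apply/andP; split; apply/eqP; field.
Qed.

Section SecondOrder.
Variables (W : set (R * R)) (Y : R * R -> 'rV[R]_6) (p : R * R).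
Hypotheses (oW : open W) (sY : smooth W Y) (Wp : W p).

Let half_reV : (fun q => reV (Yz Y q)) = (fun q => 2^-1 *: du Y q).
Proof. by apply/funext => q; rewrite reV_Yz. Qed.

Let half_imV : (fun q => imV (Yz Y q)) = (fun q => - 2^-1 *: dv Y q).
Proof. by apply/funext => q; rewrite imV_Yz. Qed.

Let sc (a : R) : smooth W (fun=> a) := smooth_cst W a.
Let su := smooth_du sY.
Let sv := smooth_dv sY.

Lemma reV_dzYz : reV (dz (Yz Y) p) = 4^-1 *: (du (du Y) p - dv (dv Y) p).
Proof.
rewrite reV_dz half_reV half_imV (duZ Wp (sc _) su) (dvZ Wp (sc _) sv) du_cst dv_cst.
by apply/rowP => k; rewrite !mxE; field.
Qed.

Lemma imV_dzYz : imV (dz (Yz Y) p) = - 2^-1 *: dv (du Y) p.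
Proof.
rewrite imV_dz half_reV half_imV (duZ Wp (sc _) sv) (dvZ Wp (sc _) su) du_cst dv_cst.
by rewrite (du_dv oW Wp sY); apply/rowP => k; rewrite !mxE; field.
Qed.

Lemma reV_dzbarYz : reV (dzbar (Yz Y) p) = 4^-1 *: laplacian Y p.
Proof.
rewrite laplacian.unlock.
rewrite reV_dzbar half_reV half_imV (duZ Wp (sc _) su) (dvZ Wp (sc _) sv) du_cst dv_cst.
by apply/rowP => k; rewrite !mxE; field.
Qed.

Lemma mem_bundleV v : reflect
  (exists c : R * R * R * R, v = c.1.1.1 *: Y p + c.1.1.2 *: du Y p
     + c.1.2 *: dv Y p + c.2 *: laplacian Y p) (v \in bundleV Y p).
Proof.
rewrite /bundleV !span_cons span_nil addv0 (reV_Yz Y p) (imV_Yz Y p) reV_dzbarYz.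
apply: (iffP memv_addP) => [[x /vlineP[a ->] [z /memv_addP[x' /vlineP[b ->]]]]|].
  move=> [z' /memv_addP[x'' /vlineP[c ->] [z'' /vlineP[d ->] ->] ->] ->].
  exists (a, b * 2^-1, c * - 2^-1, d * 4^-1) => /=.
  by rewrite !scalerA !addrA.
move=> [[[[a b] c] d]] /= ->.
exists (a *: Y p); first by apply/vlineP; exists a.
exists (b *: du Y p + c *: dv Y p + d *: laplacian Y p); last by rewrite !addrA.
apply/memv_addP; exists (b *: du Y p).
  by apply/vlineP; exists (b * 2); rewrite scalerA mulfK.
exists (c *: dv Y p + d *: laplacian Y p); last by rewrite !addrA.
apply/memv_addP; exists (c *: dv Y p).
  by apply/vlineP; exists (c * - 2); rewrite scalerA; congr (_ *: _); field.
exists (d *: laplacian Y p) => //.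
by apply/vlineP; exists (d * 4); rewrite scalerA mulfK.
Qed.

Lemma normal_vectorP x : Defs.normal Y p x <->
  [/\ qf x (Y p) = 0, qf x (du Y p) = 0, qf x (dv Y p) = 0
    & qf x (laplacian Y p) = 0].
Proof.
split=> [nx|[h1 h2 h3 h4] v /mem_bundleV[c ->]]; last first.
  by rewrite !qfE h1 h2 h3 h4 !mulr0 !addr0.
split; apply: nx; apply/mem_bundleV.
- by exists (1, 0, 0, 0) => /=; rewrite !scale0r scale1r !addr0.
- by exists (0, 1, 0, 0) => /=; rewrite !scale0r scale1r !addr0 add0r.
- by exists (0, 0, 1, 0) => /=; rewrite !scale0r scale1r !addr0 add0r.
- by exists (0, 0, 0, 1) => /=; rewrite !scale0r scale1r !add0r.
Qed.

End SecondOrder.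

End Complexification.

(** * Structure equations of an isothermic surface and of its left polar *)

Section PolarFrame.
Variable R : realType.

(** Once the first three vectors and [Y] are prescribed, orthogonality to the tangent vectors fixes
    the components along [U] and [V], nullity yields (a^2 + b^2) / 2 twice, and orthogonality of the
    last vector to the fourth gives its [L]-component. Only [e] stays free. *)
Lemma frame_polar o (Y U V N S L : 'rV[R]_6) (a b e : R) :
  frame o Y U V N S L ->
  frame o L (a *: L + U + a *: Y) (b *: L - V - b *: Y)
    (S + e *: Y + a *: U - b *: V + ((a ^+ 2 + b ^+ 2) / 2) *: L) Y
    (N + ((a ^+ 2 + b ^+ 2) / 2) *: Y + a *: U + b *: V + (a ^+ 2 - b ^+ 2 - e) *: L).
Proof.
move=> F; split; last exact: oriented_polar (fr_oriented F).
all: by rewrite ?qfE ?(frE F); field.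
Qed.

End PolarFrame.

Section RealFrames.
Variables (R : realType) (W : set (R * R)) (oW : open W) (o : bool).
Implicit Types (Y N S L : R * R -> 'rV[R]_6) (s t a b f l : R * R -> R).

(* The structure equations of an isothermic surface in real terms: the Schwarzian is
   s + it, the Hopf differential l1 L + l2 S, and the connection form is
   alpha = (a - ib) / 2. *)
Record structure_eqs Y N S L s t (l1 l2 : R * R -> R) a b : Prop := StructureEqs {
  se_smoothY : smooth W Y; se_smoothN : smooth W N;
  se_smoothS : smooth W S; se_smoothL : smooth W L;
  se_frame p : W p -> frame o (Y p) (du Y p) (dv Y p) (N p) (S p) (L p);
  se_lapS p : W p -> qf (laplacian Y p) (S p) = 0;
  se_lapL p : W p -> qf (laplacian Y p) (L p) = 0;
  se_hopf p : W p -> du (du Y) p - dv (dv Y) p =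
    (-2 * s p) *: Y p + (4 * l1 p) *: L p + (4 * l2 p) *: S p;
  se_mixed p : W p -> dv (du Y) p = t p *: Y p;
  se_a p : W p -> qf (du L p) (S p) = - a p;
  se_b p : W p -> qf (dv L p) (S p) = - b p }.

Lemma du_const (f g : R * R -> 'rV[R]_6) k p : smooth W f -> smooth W g ->
  (forall q, W q -> qf (f q) (g q) = k) -> W p ->
  qf (du f p) (g p) = - qf (f p) (du g p).
Proof.
move=> sf sg fg Wp; apply/eqP; rewrite -addr_eq0 -(du_qf Wp sf sg).
by rewrite (du_ext oW fg Wp) du_cst.
Qed.

Lemma dv_const (f g : R * R -> 'rV[R]_6) k p : smooth W f -> smooth W g ->
  (forall q, W q -> qf (f q) (g q) = k) -> W p ->
  qf (dv f p) (g p) = - qf (f p) (dv g p).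
Proof.
move=> sf sg fg Wp; apply/eqP; rewrite -addr_eq0 -(dv_qf Wp sf sg).
by rewrite (dv_ext oW fg Wp) dv_cst.
Qed.

Section Consequences.
Variables (Y N S L : R * R -> 'rV[R]_6) (s t l1 l2 a b : R * R -> R).
Hypothesis E : structure_eqs Y N S L s t l1 l2 a b.

Let sY := se_smoothY E.
Let sN := se_smoothN E.
Let sS := se_smoothS E.
Let sL := se_smoothL E.
Let sYu := smooth_du sY.
Let sYv := smooth_dv sY.
Let sLu := smooth_du sL.
Let sLv := smooth_dv sL.

(** Here and in the next three lemmas an invariant is recovered as a pairing of smooth maps, which
    makes it smooth. *)
Lemma se_smooth_a : smooth W a.
Proof.
apply: (smooth_ext oW _ (smoothN oW (smooth_qf oW sLu sS))).
by move=> p /(se_a E) ->; rewrite opprK.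
Qed.

Lemma se_smooth_b : smooth W b.
Proof.
apply: (smooth_ext oW _ (smoothN oW (smooth_qf oW sLv sS))).
by move=> p /(se_b E) ->; rewrite opprK.
Qed.

Lemma se_smooth_s : smooth W s.
Proof.
have sD := smoothB oW (smooth_du sYu) (smooth_dv sYv).
have sq := smooth_qf oW sD sN; have sM := smoothM oW (smooth_cst W (2^-1 : R)) sq.
apply: (smooth_ext oW _ sM).
move=> p Wp /=; have F := se_frame E Wp.
by rewrite (se_hopf E Wp) !qfE !(frE F); field.
Qed.

Lemma se_smooth_l2 : smooth W l2.
Proof.
have sD := smoothB oW (smooth_du sYu) (smooth_dv sYv).
have sq := smooth_qf oW sD sL; have sM := smoothM oW (smooth_cst W ((- 4^-1) : R)) sq.
apply: (smooth_ext oW _ sM).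
move=> p Wp /=; have F := se_frame E Wp.
by rewrite (se_hopf E Wp) !qfE !(frE F); field.
Qed.

Section AtPoint.
Variables (p : R * R) (Wp : W p).
Let F := se_frame E Wp.

Let YuuY : qf (du (du Y) p) (Y p) = -1.
Proof.
rewrite (du_const sYu sY (k := 0) _ Wp) ?(frE F)// => q /(se_frame E) Fq.
by rewrite !(frE Fq).
Qed.

Let YvvY : qf (dv (dv Y) p) (Y p) = -1.
Proof.
rewrite (dv_const sYv sY (k := 0) _ Wp) ?(frE F)// => q /(se_frame E) Fq.
by rewrite !(frE Fq).
Qed.

Let YuuYu : qf (du (du Y) p) (du Y p) = 0.
Proof.
have := du_const sYu sYu (k := 1) (fun q Wq => frUU (se_frame E Wq)) Wp.
rewrite (qfC (du Y p)); lra.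
Qed.

Let YvvYv : qf (dv (dv Y) p) (dv Y p) = 0.
Proof.
have := dv_const sYv sYv (k := 1) (fun q Wq => frVV (se_frame E Wq)) Wp.
rewrite (qfC (dv Y p)); lra.
Qed.

Let YuuYv : qf (du (du Y) p) (dv Y p) = 0.
Proof.
have := du_const sYu sYv (k := 0) (fun q Wq => frUV (se_frame E Wq)) Wp.
by rewrite (du_dv oW Wp sY) (se_mixed E Wp) !qfE !(frE F) mulr0 oppr0.
Qed.

Let YvvYu : qf (dv (dv Y) p) (du Y p) = 0.
Proof.
have := dv_const sYu sYv (k := 0) (fun q Wq => frUV (se_frame E Wq)) Wp.
rewrite (se_mixed E Wp) !qfE !(frE F) mulr0 (qfC (du Y p)); lra.
Qed.

Let YuuYvv_L : qf (du (du Y) p) (L p) = -2 * l2 p /\ qf (dv (dv Y) p) (L p) = 2 * l2 p.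
Proof.
have := congr1 (fun x => qf x (L p)) (se_hopf E Wp).
have := se_lapL E Wp; rewrite laplacian.unlock !qfE !(frE F).
by move=> h1 h2; split; lra.
Qed.

(** Differentiating the flat metric makes the Laplacian orthogonal to Y_u and Y_v, and it is
    orthogonal to [S] and [L] because these are normal. *)
Lemma laplacian_decomp : laplacian Y p = - qf (laplacian Y p) (N p) *: Y p + 2 *: N p.
Proof.
have lY : qf (laplacian Y p) (Y p) = -2.
  by rewrite laplacian.unlock !qfE YuuY YvvY; ring.
have lU : qf (laplacian Y p) (du Y p) = 0.
  by rewrite laplacian.unlock !qfE YuuYu YvvYu addr0.
have lV : qf (laplacian Y p) (dv Y p) = 0.
  by rewrite laplacian.unlock !qfE YuuYv YvvYv addr0.
by apply: (frame_eq F); rewrite ?lY ?lU ?lV ?(se_lapS E Wp) ?(se_lapL E Wp) !qfE !(frE F); ring.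
Qed.

(** The Gauss equation of a flat metric. Differentiating <Y_uu, Y_v> = 0 in v and <Y_uv, Y_v> = 0 in
    u gives two expressions for <Y_uuv, Y_v>; moreover Y_uv is a multiple of the null vector Y, so
    <Y_uv, Y_uv> = 0. *)
Let gauss : qf (du (du Y) p) (dv (dv Y) p) = 0.
Proof.
have h1 : forall q, W q -> qf (du (du Y) q) (dv Y q) = 0.
  move=> q Wq; have Fq := se_frame E Wq.
  have := du_const sYu sYv (k := 0) (fun q Wq => frUV (se_frame E Wq)) Wq.
  by rewrite (du_dv oW Wq sY) (se_mixed E Wq) !qfE !(frE Fq) mulr0 oppr0.
have h2 : forall q, W q -> qf (dv (du Y) q) (dv Y q) = 0.
  by move=> q Wq; rewrite (se_mixed E Wq) !qfE !(frE (se_frame E Wq)) mulr0.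
have := dv_const (smooth_du sYu) sYv h1 Wp.
rewrite -(du_dv oW Wp sYu) (du_const (smooth_dv sYu) sYv h2 Wp).
rewrite (du_dv oW Wp sY) (se_mixed E Wp) !qfE !(frE F); lra.
Qed.

(** By the Gauss equation Y_uu + Y_vv and Y_uu - Y_vv have the same square; it is -4m for the sum
    and -32 l1 l2 for the difference. *)
Lemma laplacian_normal : laplacian Y p = (8 * l1 p * l2 p) *: Y p + 2 *: N p.
Proof.
rewrite {1}laplacian_decomp; congr (_ *: _ + _); set m := - _.
have dm : laplacian Y p = m *: Y p + 2 *: N p := laplacian_decomp.
have h1 : qf (laplacian Y p) (laplacian Y p) = -4 * m.
  by rewrite {1}dm dm !qfE !(frE F); ring.
have h2 : qf (du (du Y) p - dv (dv Y) p) (du (du Y) p - dv (dv Y) p) =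
    -32 * l1 p * l2 p by rewrite (se_hopf E Wp) !qfE !(frE F); ring.
move: h1 h2; rewrite laplacian.unlock !qfE (qfC (dv (dv Y) p) (du (du Y) p)) gauss.
move=> h1 h2; lra.
Qed.

(** The Laplacian is orthogonal to [L], so Y_uu and Y_vv have opposite pairings with it; hence the
    opposite signs of 2 l2 here and in [dvL_decomp]. The component along Y is left open and found in
    [duL_polar]. *)
Lemma duL_decomp : du L p =
  - qf (du L p) (N p) *: Y p + (2 * l2 p) *: du Y p + a p *: L p.
Proof.
have hY : qf (du L p) (Y p) = 0.
  rewrite (du_const sL sY (k := 0) _ Wp) ?(frE F) ?oppr0// => q Wq.
  by rewrite !(frE (se_frame E Wq)).
have hU : qf (du L p) (du Y p) = 2 * l2 p.
  rewrite (du_const sL sYu (k := 0) _ Wp) => [|q Wq]; last by rewrite !(frE (se_frame E Wq)).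
  by rewrite qfC (YuuYvv_L.1); ring.
have hV : qf (du L p) (dv Y p) = 0.
  rewrite (du_const sL sYv (k := 0) _ Wp) => [|q Wq]; last by rewrite !(frE (se_frame E Wq)).
  by rewrite (du_dv oW Wp sY) (se_mixed E Wp) !qfE !(frE F) mulr0 oppr0.
have hL : qf (du L p) (L p) = 0.
  have := du_const sL sL (k := 0) (fun q Wq => frLL (se_frame E Wq)) Wp.
  rewrite (qfC (L p)); lra.
by apply: (frame_eq F); rewrite ?hY ?hU ?hV ?hL ?(se_a E Wp) !qfE !(frE F); ring.
Qed.

Lemma dvL_decomp : dv L p =
  - qf (dv L p) (N p) *: Y p - (2 * l2 p) *: dv Y p + b p *: L p.
Proof.
have hY : qf (dv L p) (Y p) = 0.
  rewrite (dv_const sL sY (k := 0) _ Wp) ?(frE F) ?oppr0// => q Wq.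
  by rewrite !(frE (se_frame E Wq)).
have hU : qf (dv L p) (du Y p) = 0.
  rewrite (dv_const sL sYu (k := 0) _ Wp) => [|q Wq]; last by rewrite !(frE (se_frame E Wq)).
  by rewrite (se_mixed E Wp) !qfE !(frE F) mulr0 oppr0.
have hV : qf (dv L p) (dv Y p) = - 2 * l2 p.
  rewrite (dv_const sL sYv (k := 0) _ Wp) => [|q Wq]; last by rewrite !(frE (se_frame E Wq)).
  by rewrite qfC (YuuYvv_L.2); ring.
have hL : qf (dv L p) (L p) = 0.
  have := dv_const sL sL (k := 0) (fun q Wq => frLL (se_frame E Wq)) Wp.
  rewrite (qfC (L p)); lra.
by apply: (frame_eq F); rewrite ?hY ?hU ?hV ?hL ?(se_b E Wp) !qfE !(frE F); ring.
Qed.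

End AtPoint.
End Consequences.
(** The Schwarzian and the Hopf differential ignore the choice of normal frame: only the components
    of the latter are rescaled, and the connection form gains the logarithmic derivative of [f]. *)
Lemma structure_gauge Y N S L s t (l1 l2 : R * R -> R) a b f :
  structure_eqs Y N S L s t l1 l2 a b ->
  smooth W f -> (forall p, W p -> f p != 0) ->
  structure_eqs Y N (fun p => (f p)^-1 *: S p) (fun p => f p *: L p) s t
    (fun p => (f p)^-1 * l1 p) (fun p => f p * l2 p)
    (fun p => a p + du f p / f p) (fun p => b p + dv f p / f p).
Proof.
move=> E sf f0; have sfV := smoothV oW f0 sf.
have sS := se_smoothS E; have sL := se_smoothL E.
split; [exact: se_smoothY E|exact: se_smoothN E|..].
- exact: smoothZ.
- exact: smoothZ.
- move=> p Wp; have F := se_frame E Wp; have fp := f0 p Wp.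
  by split; first [exact: oriented_scale (fr_oriented F)|rewrite ?qfE !(frE F); field].
- by move=> p Wp; rewrite qfE (se_lapS E Wp) mulr0.
- by move=> p Wp; rewrite qfE (se_lapL E Wp) mulr0.
- move=> p Wp; rewrite (se_hopf E Wp) !scalerA; have fp := f0 p Wp.
  by congr (_ + _ *: _ + _ *: _); field.
- exact: se_mixed E.
- move=> p Wp; have F := se_frame E Wp; have fp := f0 p Wp.
  by rewrite (duZ Wp sf sL) !qfE (se_a E Wp) !(frE F); field.
- move=> p Wp; have F := se_frame E Wp; have fp := f0 p Wp.
  by rewrite (dvZ Wp sf sL) !qfE (se_b E Wp) !(frE F); field.
Qed.

Section Polar.
Variables (Y N S L : R * R -> 'rV[R]_6) (s t l1 l2 a b : R * R -> R).
Hypothesis E : structure_eqs Y N S L s t l1 l2 a b.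
Hypothesis l2_half : forall p, W p -> l2 p = 2^-1.

Let sY := se_smoothY E.
Let sN := se_smoothN E.
Let sS := se_smoothS E.
Let sL := se_smoothL E.
Let sa := se_smooth_a E.
Let sb := se_smooth_b E.
Let sYu := smooth_du sY.
Let sYv := smooth_dv sY.

Lemma duL_polar p : W p -> du L p = a p *: L p + du Y p + a p *: Y p /\
  dv L p = b p *: L p - dv Y p - b p *: Y p.
Proof.
pose P q := - qf (du L q) (N q); pose Q q := - qf (dv L q) (N q).
have sP : smooth W P by apply: smoothN => //; apply: smooth_qf => //; exact: smooth_du.
have sQ : smooth W Q by apply: smoothN => //; apply: smooth_qf => //; exact: smooth_dv.
have dL q : W q -> du L q = P q *: Y q + du Y q + a q *: L q.
  by move=> Wq; rewrite (duL_decomp E Wq) (l2_half Wq) mulfV// scale1r.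
have dL' q : W q -> dv L q = Q q *: Y q - dv Y q + b q *: L q.
  by move=> Wq; rewrite (dvL_decomp E Wq) (l2_half Wq) mulfV// scale1r.
move=> Wp; have F := se_frame E Wp.
have sPY := smoothZ oW sP sY; have sQY := smoothZ oW sQ sY.
have saL := smoothZ oW sa sL; have sbL := smoothZ oW sb sL.
have LL : dv (du L) p = du (dv L) p by rewrite (du_dv oW Wp sL).
have E1 := dv_ext oW dL Wp; have E2 := du_ext oW dL' Wp.
rewrite (dvD Wp (smoothD oW sPY sYu) saL) (dvD Wp sPY sYu) in E1.
rewrite (dvZ Wp sP sY) (dvZ Wp sa sL) in E1.
rewrite (duD Wp (smoothB oW sQY sYv) sbL) (duD Wp sQY (smoothN oW sYv)) in E2.
rewrite (duN Wp sYv) (duZ Wp sQ sY) (duZ Wp sb sL) in E2.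
rewrite (dL p Wp) (du_dv oW Wp sY) in E2; rewrite (dL' p Wp) in E1.
rewrite E1 E2 (se_mixed E Wp) in LL.
(* [P] is read off the Y_v-component of the equality of mixed partials, [Q] off its
   Y_u-component. *)
have PA : P p = a p.
  by have := congr1 (fun x => qf x (dv Y p)) LL; rewrite /= !qfE !(frE F); lra.
have QB : Q p = - b p.
  by have := congr1 (fun x => qf x (du Y p)) LL; rewrite /= !qfE !(frE F); lra.
rewrite dL// dL'// PA QB; split; apply/rowP => k; rewrite !mxE; ring.
Qed.

Let saY := smoothZ oW sa sY.
Let sbY := smoothZ oW sb sY.
Let saL := smoothZ oW sa sL.
Let sbL := smoothZ oW sb sL.
Let hu p (Wp : W p) := (duL_polar Wp).1.
Let hv p (Wp : W p) := (duL_polar Wp).2.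

Let Luu p : W p -> du (du L) p = du a p *: L p + a p *: du L p + du (du Y) p
  + (du a p *: Y p + a p *: du Y p).
Proof.
move=> Wp; rewrite (du_ext oW hu Wp) (duD Wp (smoothD oW saL sYu) saY) (duD Wp saL sYu).
by rewrite (duZ Wp sa sL) (duZ Wp sa sY).
Qed.

Let Lvv p : W p -> dv (dv L) p = dv b p *: L p + b p *: dv L p - dv (dv Y) p
  - (dv b p *: Y p + b p *: dv Y p).
Proof.
move=> Wp; rewrite (dv_ext oW hv Wp) (dvD Wp (smoothB oW sbL sYv) (smoothN oW sbY)).
rewrite (dvN Wp sbY) (dvD Wp sbL (smoothN oW sYv)) (dvN Wp sYv).
by rewrite (dvZ Wp sb sL) (dvZ Wp sb sY).
Qed.

(** This is the reality of the Hopf differential of L. In the two computations of the mixed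
    derivative, equality of the L-components gives a_v = b_u; the Y-components are then opposite as
    well as equal, so they vanish. *)
Let Luv p : W p -> dv (du L) p = (dv a p + a p * b p) *: L p.
Proof.
move=> Wp; have F := se_frame E Wp.
have E1 : dv (du L) p = (dv a p + a p * b p) *: L p + (t p + dv a p - a p * b p) *: Y p.
  rewrite (dv_ext oW hu Wp) (dvD Wp (smoothD oW saL sYu) saY) (dvD Wp saL sYu).
  rewrite (dvZ Wp sa sL) (dvZ Wp sa sY) (se_mixed E Wp) (hv Wp).
  by apply/rowP => k; rewrite !mxE; ring.
have E2 : du (dv L) p = (du b p + a p * b p) *: L p + (a p * b p - t p - du b p) *: Y p.
  rewrite (du_ext oW hv Wp) (duD Wp (smoothB oW sbL sYv) (smoothN oW sbY)).
  rewrite (duN Wp sbY) (duD Wp sbL (smoothN oW sYv)) (duN Wp sYv).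
  rewrite (duZ Wp sb sL) (duZ Wp sb sY) (du_dv oW Wp sY) (se_mixed E Wp) (hu Wp).
  by apply/rowP => k; rewrite !mxE; ring.
have E3 := du_dv oW Wp sL; rewrite E1 E2 in E3.
have h1 : dv a p = du b p.
  by have := congr1 (fun x => qf x (S p)) E3; rewrite /= !qfE !(frE F); lra.
have h2 : t p + dv a p - a p * b p = 0.
  by have := congr1 (fun x => qf x (N p)) E3; rewrite /= !qfE !(frE F); lra.
by rewrite E1 h2 scale0r addr0.
Qed.

(** Half the Y-component of L_uu + L_vv. With this value of the free parameter of [frame_polar], the
    Laplacian of L is twice [polar_N] plus a multiple of L. *)
Let e q := - s q + (a q ^+ 2 - b q ^+ 2) / 2 + (du a q - dv b q) / 2.
Let m q := (a q ^+ 2 + b q ^+ 2) / 2.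

Definition polar_N q := S q + e q *: Y q + a q *: du Y q - b q *: dv Y q + m q *: L q.
Definition polar_dual q :=
  N q + m q *: Y q + a q *: du Y q + b q *: dv Y q + (a q ^+ 2 - b q ^+ 2 - e q) *: L q.

Let sab2 f : smooth W f -> smooth W (fun q => f q ^+ 2).
Proof. by move=> sf; have := smoothM oW sf sf; under eq_fun do rewrite -expr2. Qed.

Let shalf f : smooth W f -> smooth W (fun q => f q / 2).
Proof. by move=> sf; apply: smoothM => //; exact: smooth_cst. Qed.

Let se : smooth W e.
Proof.
apply: smoothD => //; last first.
  by apply: shalf; apply: smoothB => //; [exact: smooth_du|exact: smooth_dv].
apply: smoothD => //; first by apply: smoothN => //; exact: se_smooth_s E.
by apply: shalf; apply: smoothB => //; exact: sab2.
Qed.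

Let sm : smooth W m.
Proof. by apply: shalf; apply: smoothD => //; exact: sab2. Qed.

(** The second invariant is the imaginary part t + b_u + a_v of s - 4 alpha_z, rewritten with t = a
    b - a_v and a_v = b_u. The latter also makes (conj alpha)_z real, equal to (a_u + b_v) / 4. *)
Lemma structure_polar : structure_eqs L polar_N Y polar_dual
  (fun q => s q - du a q + dv b q) (fun q => dv a q + a q * b q)
  (fun=> 2^-1) (fun q => l1 q + (du a q + dv b q) / 4) a b.
Proof.
have sX : smooth W polar_dual.
  apply: smoothD => //; last first.
    apply: smoothZ => //; apply: smoothB => //; apply: smoothB => //; exact: sab2.
  by do 2?[apply: smoothD => //; last exact: smoothZ]; apply: smoothD => //; exact: smoothZ.
have sPN : smooth W polar_N.
  apply: smoothD => //; last exact: smoothZ.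
  apply: smoothB => //; last exact: smoothZ.
  by do 2?[apply: smoothD => //; last exact: smoothZ].
have Fr p : W p -> frame o (L p) (du L p) (dv L p) (polar_N p) (Y p) (polar_dual p).
  by move=> Wp; rewrite hu// hv//; exact: frame_polar (se_frame E Wp).
have lap p : W p -> laplacian Y p = (4 * l1 p) *: Y p + 2 *: N p.
  by move=> Wp; rewrite (laplacian_normal E Wp) (l2_half Wp); congr (_ *: _ + _); field.
have hopf p : W p -> du (du L) p - dv (dv L) p =
   (-2 * (s p - du a p + dv b p)) *: L p + (4 * 2^-1) *: polar_dual p
     + (4 * (l1 p + (du a p + dv b p) / 4)) *: Y p.
  move=> Wp; have := lap p Wp; rewrite laplacian.unlock => h.
  rewrite Luu// Lvv// hu// hv// /polar_dual /m /e.
  have -> : dv (dv Y) p = (4 * l1 p) *: Y p + 2 *: N p - du (du Y) p by rewrite -h addrC addKr.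
  by apply/rowP => k; rewrite !mxE; field.
have lapL p : W p -> laplacian L p = 2 *: polar_N p + (du a p + dv b p + 4 * l1 p) *: L p.
  move=> Wp; have h := se_hopf E Wp; rewrite laplacian.unlock.
  rewrite Luu// Lvv// hu// hv// /polar_N /m /e.
  have -> : du (du Y) p = dv (dv Y) p + (-2 * s p *: Y p + 4 * l1 p *: L p + 4 * l2 p *: S p).
    by rewrite -h addrC subrK.
  by rewrite (l2_half Wp); apply/rowP => k; rewrite !mxE; field.
split => //.
- by move=> p Wp; rewrite lapL// qfDl !qfZl !(frE (Fr p Wp)) !mulr0 addr0.
- by move=> p Wp; rewrite lapL// qfDl !qfZl !(frE (Fr p Wp)) !mulr0 addr0.
(* The derivative is moved from the dual to Y; the dual pairs with Y_u to [a], and in the next case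
   with Y_v to [b], so the connection form is unchanged. *)
- move=> p Wp; rewrite (du_const sX sY (k := -1) _ Wp) => [|q Wq].
    by rewrite /polar_dual !qfE !(frE (se_frame E Wp)); ring.
  by rewrite !(frE (Fr q Wq)).
- move=> p Wp; rewrite (dv_const sX sY (k := -1) _ Wp) => [|q Wq].
    by rewrite /polar_dual !qfE !(frE (se_frame E Wp)); ring.
  by rewrite !(frE (Fr q Wq)).
Qed.

End Polar.
End RealFrames.

(** * Complex invariants and real structure equations *)

Section Conversion.
Variables (R : realType) (W : set (R * R)) (oW : open W) (o : bool).
Implicit Types (Y N S L : R * R -> 'rV[R]_6).

Lemma derive_uv (V : normedModType R) (f : R * R -> V) p w :
  smooth W f -> W p -> 'D_w f p = w.1 *: du f p + w.2 *: dv f p.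
Proof.
move=> sf Wp; rewrite derive_basis ?duE ?dvE//.
exact: smooth_differentiable sf Wp.
Qed.

Lemma canonicalP y Y : local_lift W y Y -> (canonical_lift W y Y <->
  forall p, W p -> [/\ qf (du Y p) (du Y p) = 1, qf (du Y p) (dv Y p) = 0
    & qf (dv Y p) (dv Y p) = 1]).
Proof.
move=> lY; have sY := lY.1; split=> [[_ H] p Wp|H].
  (* Polarisation: three directions determine the three coefficients of the metric. *)
  have h w := H p w Wp; move: (h (1, 0)) (h (0, 1)) (h (1, 1)).
  rewrite !(derive_uv _ sY Wp) /= !qfE (qfC (dv Y p) (du Y p)).
  by move=> h1 h2 h3; split; lra.
split=> // p w Wp; have [h1 h2 h3] := H p Wp.
by rewrite !(derive_uv _ sY Wp) !qfE (qfC (dv Y p) (du Y p)) h1 h2 h3; ring.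
Qed.

(** A normal [x] does not see the tangential part of psi_z - c psi; the factors 2 and -2 come from
    psi_z = (psi_u - i psi_v) / 2. *)
Lemma is_Dz_toC (psi : R * R -> 'rV[R]_6) Y p (c : R[i]) : 
  is_Dz Y psi p (c *: toC (psi p)) -> forall x, Defs.normal Y p x ->
  qf (du psi p) x = 2 * complex.Re c * qf (psi p) x /\
  qf (dv psi p) x = - 2 * complex.Im c * qf (psi p) x.
Proof.
move=> [_ [re im]] x nx; have := nx _ re; have := nx _ im.
rewrite -/(Yz psi p); move: (Yz psi p) (reV_Yz psi p) (imV_Yz psi p) => D hr hi.
rewrite !reimE hr hi !qfE (qfC x (du psi p)) (qfC x (dv psi p)) (qfC x (psi p)) => h1 h2.
by split; lra.
Qed.

Section ToStructure.
Variables (M : set (R * R)) (y : R * R -> quadric R) (Y N L S : R * R -> 'rV[R]_6).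
Hypothesis WM : open_in M W.
Hypothesis C : canonical_framing o W y Y N L S.

Let sY : smooth W Y. Proof. by case: C => [[[]]]. Qed.

Lemma framing_frame p : W p -> frame o (Y p) (du Y p) (dv Y p) (N p) (S p) (L p).
Proof.
move=> Wp; have [canY [sN HN] [sL sS HF]] := C.
have [hUU hUV hVV] := (canonicalP canY.1).1 canY p Wp.
have YY q : W q -> qf (Y q) (Y q) = 0 by move=> /canY.1.2[].
have hYU : qf (Y p) (du Y p) = 0.
  by have := du_const oW sY sY YY Wp; rewrite (qfC (du Y p)); lra.
have hYV : qf (Y p) (dv Y p) = 0.
  by have := dv_const oW sY sY YY Wp; rewrite (qfC (dv Y p)); lra.
have [NV N1 _ NN NY] := HN p Wp.
have [[nL nS] LL SS LS or] := HF p Wp; rewrite duE dvE in or.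
have [[LY LU LV _] [SY SU SV _]] := ((normal_vectorP sY Wp _).1 nL, (normal_vectorP sY Wp _).1 nS).
have NL := nL _ NV; have NS := nS _ NV.
move: N1; rewrite qf_complex reV_Yz imV_Yz reV_toC imV_toC !qfE => /eqP.
rewrite eq_complex /= => /andP[/eqP NU /eqP NV'].
have NU' : qf (du Y p) (N p) = 0 by rewrite qfC; lra.
have NV0 : qf (dv Y p) (N p) = 0 by rewrite qfC; lra.
by split=> //; first [exact: YY|rewrite qfC].
Qed.

Lemma framing_lap p : W p ->
  qf (laplacian Y p) (S p) = 0 /\ qf (laplacian Y p) (L p) = 0.
Proof.
move=> Wp; have [_ _ [_ _ HF]] := C; have [[nL nS] _ _ _ _] := HF p Wp.
have [_ _ _ hL] := (normal_vectorP sY Wp _).1 nL.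
have [_ _ _ hS] := (normal_vectorP sY Wp _).1 nS.
by rewrite !(qfC (laplacian Y p)).
Qed.

Variables (s lam1 lam2 alpha : R * R -> R[i]).
Hypothesis I : invariants W Y L S s lam1 lam2 alpha.
Hypothesis iso : isothermic M y.

Lemma lambda_real p : W p -> complex.Im (lam1 p) = 0 /\ complex.Im (lam2 p) = 0.
Proof.
move=> Wp; have F := framing_frame Wp; have [canY _ _] := C.
have [_] := iso.2 _ _ _ _ WM canY I.1 p Wp.
move=> /(congr1 (@imV R)); rewrite imV_conj !reimE !scaler0 !add0r => h.
have hS := congr1 (fun x => qf x (S p)) h; have hL := congr1 (fun x => qf x (L p)) h.
by move: hS hL; rewrite /= !qfE !(frE F) => hS hL; split; lra.
Qed.

Lemma framing_structure : structure_eqs W o Y N S L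
  (fun p => complex.Re (s p)) (fun p => complex.Im (s p))
  (fun p => complex.Re (lam1 p)) (fun p => complex.Re (lam2 p))
  (fun p => 2 * complex.Re (alpha p)) (fun p => - 2 * complex.Im (alpha p)).
Proof.
have [canY [sN HN] [sL sS HF]] := C.
have key p (Wp : W p) := (I.1 p Wp).1.
split=> //.
- exact: framing_frame.
- by move=> p /framing_lap[].
- by move=> p /framing_lap[].
- move=> p Wp; have := congr1 (@reV R) (key p Wp).
  rewrite (reV_dzYz sY Wp) !reimE /= !scaler0 !subr0.
  move=> /(congr1 (fun x => 4 *: x)); rewrite scalerA mulfV// scale1r => ->.
  by apply/rowP => k; rewrite !mxE; case: (s p) => u v /=; field.
- move=> p Wp; have := congr1 (@imV R) (key p Wp).
  have [I1 I2] := lambda_real Wp.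
  rewrite (imV_dzYz oW sY Wp) !reimE I1 I2 /= !(scaler0, scale0r, add0r, addr0).
  move=> /(congr1 (fun x => -2 *: x)); rewrite !scalerA mulrNN mulfV// scale1r => ->.
  by congr (_ *: _); case: (s p) => u v /=; field.
- move=> p Wp; have F := framing_frame Wp; have [[_ nS] _ _ _ _] := HF p Wp.
  have [dL _] := I.2 p Wp; have [-> _] := is_Dz_toC dL nS.
  by rewrite !(frE F); ring.
- move=> p Wp; have F := framing_frame Wp; have [[_ nS] _ _ _ _] := HF p Wp.
  have [dL _] := I.2 p Wp; have [_ ->] := is_Dz_toC dL nS.
  by rewrite !(frE F); ring.
Qed.

End ToStructure.
End Conversion.

Section FromStructure.
Variables (R : realType) (W : set (R * R)) (oW : open W) (o : bool).
Variables (Y N S L : R * R -> 'rV[R]_6) (s t l1 l2 a b : R * R -> R).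
Hypothesis E : structure_eqs W o Y N S L s t l1 l2 a b.

Let sY := se_smoothY E.

Lemma structure_bundleN p : W p -> N p \in bundleV Y p.
Proof.
move=> Wp; apply/(mem_bundleV sY Wp).
(* The coefficients solve [laplacian_decomp] for [N]. *)
exists (2^-1 * qf (laplacian Y p) (N p), 0, 0, 2^-1) => /=.
rewrite {2}(laplacian_decomp oW E Wp).
by apply/rowP => k; rewrite !mxE; field.
Qed.

Lemma structure_normalL p : W p -> Defs.normal Y p (L p).
Proof.
move=> Wp; have F := se_frame E Wp; apply/(normal_vectorP sY Wp).
by rewrite (qfC (L p) (laplacian _ _)) (se_lapL E Wp) !(frE F).
Qed.

Lemma structure_normalS p : W p -> Defs.normal Y p (S p).
Proof.
move=> Wp; have F := se_frame E Wp; apply/(normal_vectorP sY Wp).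
by rewrite (qfC (S p) (laplacian _ _)) (se_lapS E Wp) !(frE F).
Qed.

Lemma structure_bundle p x : W p -> qf x (L p) = 0 -> qf x (S p) = 0 ->
  x \in bundleV Y p.
Proof.
move=> Wp xL xS; rewrite (frame_decomp (se_frame E Wp) x) xL xS !scale0r !subr0.
have mV v : v \in [:: Y p; du Y p; dv Y p] -> v \in bundleV Y p.
  move=> hv; apply/(mem_bundleV sY Wp); move: hv.
  rewrite !inE => /or3P[] /eqP ->; [exists (1, 0, 0, 0)|exists (0, 1, 0, 0)|exists (0, 0, 1, 0)];
    by rewrite /= ?scale0r ?scale1r ?addr0 ?add0r.
by rewrite rpredB ?rpredD ?rpredZ ?structure_bundleN ?mV ?inE ?eqxx ?orbT.
Qed.

Variables (y : R * R -> quadric R).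
Hypothesis lineY : forall p, W p -> line (y p) = <[Y p]>%VS.

Lemma structure_local_lift : local_lift W y Y.
Proof.
split=> // p Wp; have F := se_frame E Wp; split; [by rewrite (frE F)| |exact: lineY].
apply/eqP => Y0; have := frYN F; rewrite Y0 qf0l => /eqP.
by rewrite eq_sym oppr_eq0 oner_eq0.
Qed.

Lemma structure_framing : canonical_framing o W y Y N L S.
Proof.
split.
- apply/(canonicalP structure_local_lift) => p Wp.
  by have F := se_frame E Wp; rewrite !(frE F).
- split=> [|p Wp]; first exact: se_smoothN E.
  have F := se_frame E Wp; split; rewrite ?(frE F)//; first exact: structure_bundleN.
  + by rewrite qf_complex reV_Yz imV_Yz reV_toC imV_toC !qfE !(frE F) !(mulr0, addr0, subr0).
  + by rewrite qf_complex reV_Yzbar imV_Yzbar reV_toC imV_toC !qfE !(frE F) !(mulr0, addr0, subr0).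
- split; [exact: se_smoothL E|exact: se_smoothS E|move=> p Wp].
  have F := se_frame E Wp; split; rewrite ?(frE F)//.
  + by split; [exact: structure_normalL|exact: structure_normalS].
  + by rewrite duE dvE; exact: fr_oriented F.
Qed.

Lemma structure_hopf : schwarzian_hopf W Y (fun p => (s p +i* t p)%C)
  (fun p => (l1 p)%:C%C *: toC (L p) + (l2 p)%:C%C *: toC (S p)).
Proof.
move=> p Wp; split.
  move: (dz _ p) (reV_dzYz sY Wp) (imV_dzYz oW sY Wp) => D hr hi.
  apply: eqCV; rewrite !vec_reimE ?hr ?hi !cpx_reimE.
    rewrite (se_hopf E Wp) /=.
    by apply/rowP => k; rewrite !mxE; field.
  rewrite (se_mixed E Wp) /=.
  by apply/rowP => k; rewrite !mxE; field.
have nL := (normal_vectorP sY Wp _).1 (structure_normalL Wp).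
have nS := (normal_vectorP sY Wp _).1 (structure_normalS Wp).
have [L1 L2 L3 L4] := nL; have [S1 S2 S3 S4] := nS.
split; rewrite !reimE; apply/(normal_vectorP sY Wp);
  by rewrite !scaler0 ?scale0r ?subr0 ?addr0 !qfE ?L1 ?L2 ?L3 ?L4 ?S1 ?S2 ?S3 ?S4 ?mulr0 ?addr0.
Qed.

(** A converse of [is_Dz_toC]: [L] and [S] suffice as test vectors, since by [structure_bundle] a
    vector orthogonal to both is tangent. *)
Lemma is_DzP (psi : R * R -> 'rV[R]_6) p (c : R[i]) : W p ->
  Defs.normal Y p (psi p) ->
  (forall x, x = L p \/ x = S p ->
    qf (du psi p) x = 2 * complex.Re c * qf (psi p) x /\
    qf (dv psi p) x = - 2 * complex.Im c * qf (psi p) x) ->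
  is_Dz Y psi p (c *: toC (psi p)).
Proof.
move=> Wp npsi H; have [LL SS] := (H _ (or_introl erefl), H _ (or_intror erefl)).
split.
  split; rewrite !reimE !(scaler0, subr0, add0r) => v Vv; by rewrite qfZl npsi ?mulr0.
rewrite /tangentC -/(Yz psi p).
move: (Yz psi p) (reV_Yz psi p) (imV_Yz psi p) => D hr hi.
rewrite !reimE hr hi !(scaler0, subr0, add0r).
split; apply: structure_bundle => //; rewrite !qfE ?LL.1 ?LL.2 ?SS.1 ?SS.2; by field.
Qed.

Lemma structure_invariants : invariants W Y L S (fun p => (s p +i* t p)%C)
  (fun p => (l1 p)%:C%C) (fun p => (l2 p)%:C%C)
  (fun p => (a p / 2 +i* (- b p / 2))%C).
Proof.
split; first exact: structure_hopf.
move=> p Wp; have F := se_frame E Wp.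
have sL := se_smoothL E; have sS := se_smoothS E.
have LL q : W q -> qf (L q) (L q) = 0 by move=> /(se_frame E) Fq; rewrite (frE Fq).
have SS q : W q -> qf (S q) (S q) = 0 by move=> /(se_frame E) Fq; rewrite (frE Fq).
have SL q : W q -> qf (S q) (L q) = -1 by move=> /(se_frame E) Fq; rewrite (frE Fq).
have uL := du_const oW sL sL LL Wp; have vL := dv_const oW sL sL LL Wp.
have uS := du_const oW sS sS SS Wp; have vS := dv_const oW sS sS SS Wp.
(* Constancy of <S, L> transfers the connection form from [L] to [S] with the opposite sign. *)
have uSL := du_const oW sS sL SL Wp; have vSL := dv_const oW sS sL SL Wp.
have aL := se_a E Wp; have bL := se_b E Wp.
rewrite (qfC (L p)) in uL; rewrite (qfC (L p)) in vL.
rewrite (qfC (S p)) in uS; rewrite (qfC (S p)) in vS.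
rewrite (qfC (S p)) aL in uSL; rewrite (qfC (S p)) bL in vSL.
split.
- apply: is_DzP => //; first exact: structure_normalL.
  by move=> x [->|->] /=; rewrite !(frE F); split; rewrite ?aL ?bL; lra.
- apply: is_DzP => //; first exact: structure_normalS.
  by move=> x [->|->]; rewrite !cpx_reimE /= !(frE F); split; rewrite ?uSL ?vSL; lra.
Qed.

End FromStructure.

(** * Uniqueness of canonical lifts and of polar lines *)

Section CanonicalLifts.
Variables (R : realType) (W W' : set (R * R)) (oW : open W) (oW' : open W').
Variables (o : bool) (y : R * R -> quadric R) (Y N S L Y' : R * R -> 'rV[R]_6).
Variables (s t l1 l2 a b : R * R -> R).
Hypothesis E : structure_eqs W o Y N S L s t l1 l2 a b.
Hypothesis lineY : forall p, W p -> line (y p) = <[Y p]>%VS.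
Hypothesis canY' : canonical_lift W' y Y'.

Let X := W `&` W'.
Let oX : open X := openI oW oW'.
Let sY : smooth X Y := smooth_sub (@subIsetl _ W W') (se_smoothY E).
Let sN : smooth X N := smooth_sub (@subIsetl _ W W') (se_smoothN E).
Let sY' : smooth X Y' := smooth_sub (@subIsetr _ W W') canY'.1.1.
Let sYu := smooth_du sY.
Let sYv := smooth_dv sY.
(** The factor in Y' = m Y, written through <Y, N> = -1 so that its smoothness is evident. *)
Let m q := - qf (Y' q) (N q).
Let sm : smooth X m := smoothN oX (smooth_qf oX sY' sN).

Let Y'E q : X q -> Y' q = m q *: Y q.
Proof.
move=> [Wq W'q]; have [_ _ l'] := canY'.1.2 q W'q.
have /vlineP[k kE] : Y' q \in <[Y q]>%VS by rewrite -lineY// l' memv_line.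
by rewrite /m kE qfZl (frYN (se_frame E Wq)) mulrN1 opprK.
Qed.

Let duY' q : X q -> du Y' q = du m q *: Y q + m q *: du Y q.
Proof. by move=> Xq; rewrite (du_ext oX Y'E Xq) (duZ Xq sm sY). Qed.

Let dvY' q : X q -> dv Y' q = dv m q *: Y q + m q *: dv Y q.
Proof. by move=> Xq; rewrite (dv_ext oX Y'E Xq) (dvZ Xq sm sY). Qed.

Let mm q : X q -> m q *: m q = 1.
Proof.
move=> Xq; have F := se_frame E Xq.1.
have [h _ _] := (canonicalP canY'.1).1 canY' q Xq.2.
by rewrite -h (duY' Xq) !qfE !(frE F) /GRing.scale/=; ring.
Qed.

Let m0 q : X q -> m q != 0.
Proof.
move=> Xq; apply/eqP => m0; have := mm Xq; rewrite m0 scale0r => /eqP.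
by rewrite eq_sym oner_eq0.
Qed.

Let dum q : X q -> du m q = 0.
Proof.
move=> Xq; have := du_ext oX mm Xq; rewrite du_cst (duZ Xq sm sm) => h.
have : 2 * m q * du m q = 0 by rewrite -h /GRing.scale/=; ring.
by move/eqP; rewrite !mulf_eq0 pnatr_eq0/= (negPf (m0 Xq))/= => /eqP.
Qed.

Let dvm q : X q -> dv m q = 0.
Proof.
move=> Xq; have := dv_ext oX mm Xq; rewrite dv_cst (dvZ Xq sm sm) => h.
have : 2 * m q * dv m q = 0 by rewrite -h /GRing.scale/=; ring.
by move/eqP; rewrite !mulf_eq0 pnatr_eq0/= (negPf (m0 Xq))/= => /eqP.
Qed.

Let duY'E q : X q -> du Y' q = m q *: du Y q.
Proof. by move=> Xq; rewrite duY'// dum// scale0r add0r. Qed.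

Let dvY'E q : X q -> dv Y' q = m q *: dv Y q.
Proof. by move=> Xq; rewrite dvY'// dvm// scale0r add0r. Qed.

(** Comparing the metrics gives m^2 = 1, and differentiating this relation kills the derivatives of
    [m], so every derivative of the lift scales by the same sign. The sign may depend on the
    point. *)
Lemma canonical_lift_unique p : W p -> W' p -> exists2 k : R, k ^+ 2 = 1 &
  [/\ Y' p = k *: Y p, du Y' p = k *: du Y p, dv Y' p = k *: dv Y p,
      dv (du Y') p = k *: dv (du Y) p
    & du (du Y') p = k *: du (du Y) p /\ dv (dv Y') p = k *: dv (dv Y) p].
Proof.
move=> Wp W'p; have Xp : X p by [].
exists (m p); first by rewrite -(mm Xp) expr2.
split; [exact: Y'E|exact: duY'E|exact: dvY'E| |split].
- by rewrite (dv_ext oX duY'E Xp) (dvZ Xp sm sYu) dvm// scale0r add0r.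
- by rewrite (du_ext oX duY'E Xp) (duZ Xp sm sYu) dum// scale0r add0r.
- by rewrite (dv_ext oX dvY'E Xp) (dvZ Xp sm sYv) dvm// scale0r add0r.
Qed.

Lemma normal_canonical p x : W p -> W' p -> Defs.normal Y' p x <-> Defs.normal Y p x.
Proof.
move=> Wp W'p; have [k k1 [EY Eu Ev _ [Euu Evv]]] := canonical_lift_unique Wp W'p.
have k0 : k != 0 by apply: contra_eq_neq k1 => ->; rewrite expr0n eq_sym oner_eq0.
have Elap : laplacian Y' p = k *: laplacian Y p.
  by rewrite laplacian.unlock Euu Evv scalerDr.
have sY0 := se_smoothY E; have sY1 := canY'.1.1.
split=> [/(normal_vectorP sY1 W'p)|/(normal_vectorP sY0 Wp)] [h1 h2 h3 h4].
- apply/(normal_vectorP sY0 Wp); move: h1 h2 h3 h4; rewrite EY Eu Ev Elap !qfZr.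
  by do 4!(move/eqP; rewrite mulf_eq0 (negPf k0)/= => /eqP ->).
- apply/(normal_vectorP sY1 W'p); rewrite EY Eu Ev Elap !qfZr h1 h2 h3 h4.
  by rewrite mulr0.
Qed.

(** [isothermic] quantifies over all splittings of Y_zz, so [kappa] has to be identified. It is
    known modulo Y, and its Y-component vanishes by pairing with [N], which lies in V while [kappa]
    is normal. *)
Lemma hopf_canonical s' kappa : schwarzian_hopf W' Y' s' kappa ->
  forall p, W p -> W' p -> exists2 k : R, k ^+ 2 = 1 &
    reV (kappa p) = k *: (l1 p *: L p + l2 p *: S p) /\ imV (kappa p) = 0.
Proof.
move=> H p Wp W'p; have [k k1 [EY Eu Ev Euv [Euu Evv]]] := canonical_lift_unique Wp W'p.
exists k => //; have F := se_frame E Wp; have sY1 := canY'.1.1.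
have [eq [nre nim]] := H p W'p.
have hr := reV_dzYz sY1 W'p; have hi := imV_dzYz oW' sY1 W'p.
rewrite eq in hr hi; move: hr hi; rewrite !vec_reimE EY Euu Evv Euv.
rewrite -scalerBr (se_hopf E Wp) (se_mixed E Wp) !scaler0 ?addr0 ?add0r ?subr0.
move: (complex.Re _) (complex.Im _) => c d hr hi.
have NV := structure_bundleN oW E Wp.
have nN x : Defs.normal Y' p x -> qf x (N p) = 0.
  by move=> /(normal_canonical _ Wp W'p) /(_ _ NV).
have {}hr : reV (kappa p) =
    k *: ((- 2^-1 * s p) *: Y p + l1 p *: L p + l2 p *: S p) - (c * k) *: Y p.
  move/(canRL (addKr _)): hr => ->.
  by apply/rowP => i; rewrite !mxE; field.
have {}hi : imV (kappa p) = (- 2^-1 * k * t p - d * k) *: Y p.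
  move/(canRL (addKr _)): hi => ->.
  by apply/rowP => i; rewrite !mxE; field.
have r0 := nN _ nre; have i0 := nN _ nim.
move: r0 i0; rewrite hr hi !qfE !(frE F) => r0 i0; split.
  have -> : c * k = - (k * (2^-1 * s p)) by lra.
  by apply/rowP => i; rewrite !mxE; field.
have -> : - 2^-1 * k * t p - d * k = 0 by lra.
by rewrite scale0r.
Qed.

End CanonicalLifts.

(** * Isothermic surfaces from local structure equations *)

Section Isothermic.
Variables (R : realType) (o : bool) (M : set (R * R)) (y : R * R -> quadric R).

(* Around [phi p], a lift of [y \o phi] is a scalar multiple of [Y \o phi], and scalar
   multiples of an isotropic map are conformal to it. *)
Lemma lift_comp_qf W (oW : open W) (Y N S L : R * R -> 'rV[R]_6)
    (s t l1 l2 a b : R * R -> R) (E : structure_eqs W o Y N S L s t l1 l2 a b)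
    (lineY : forall p, W p -> line (y p) = <[Y p]>%VS)
    (O : set (R * R)) (phi : R * R -> R * R) (Z : R * R -> 'rV[R]_6) p :
  coordinate_inverse M O phi -> local_lift O (y \o phi) Z -> O p -> W (phi p) ->
  exists2 k : R, 0 < k & [/\ qf (du Z p) (du Z p) = k, qf (dv Z p) (dv Z p) = k
    & qf (du Z p) (dv Z p) = 0].
Proof.
move=> [oO _ sphi _ CR] lZ Op Wp; have sY := se_smoothY E; have sN := se_smoothN E.
have sZ := lZ.1; have F := se_frame E Wp.
have dphi : differentiable phi p := smooth_differentiable sphi Op.
have dY : differentiable Y (phi p) := smooth_differentiable sY Wp.
have dN : differentiable N (phi p) := smooth_differentiable sN Wp.
have dYphi : differentiable (Y \o phi) p by exact: differentiable_comp.
have dNphi : differentiable (N \o phi) p by exact: differentiable_comp.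
have dZ : differentiable Z p := smooth_differentiable sZ Op.
(* The scale factor is again a pairing with [N]. Its derivatives only add multiples of Y, which is
   null and orthogonal to Y_u and Y_v. *)
pose m q := - qf (Z q) ((N \o phi) q).
have dm : differentiable m p by apply: differentiableN; exact: differentiable_qf.
have ZE q : O q -> W (phi q) -> Z q = m q *: (Y \o phi) q.
  move=> Oq Wq; have [_ _ l'] := lZ.2 q Oq.
  have /vlineP[k kE] : Z q \in <[Y (phi q)]>%VS by rewrite -lineY// l' memv_line.
  by rewrite /m /= kE qfZl (frYN (se_frame E Wq)) mulrN1 opprK.
have nearZ : \forall q \near p, Z q = m q *: (Y \o phi) q.
  have nW : \forall q \near p, W (phi q).
    by apply: (differentiable_continuous dphi); exact: open_nbhs_nbhs.
  have nO : \forall q \near p, O q by exact: open_nbhs_nbhs.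
  by apply: filterS2 nW nO => q Wq Oq; exact: ZE.
have Dphi w : 'D_w (Y \o phi) p =
    ('D_w phi p).1 *: du Y (phi p) + ('D_w phi p).2 *: dv Y (phi p).
  rewrite deriveE// (diff_comp dphi dY) /= -deriveE// -deriveE//.
  exact: derive_uv sY Wp.
have DZ w : 'D_w Z p = 'D_w m p *: Y (phi p) +
    m p *: (('D_w phi p).1 *: du Y (phi p) + ('D_w phi p).2 *: dv Y (phi p)).
  by rewrite (near_eq_derive _ nearZ) (scale_derive w dm dYphi).2 Dphi.
have m0 : m p != 0.
  apply/eqP => m0; have [_ Z0 _] := lZ.2 p Op.
  by rewrite (ZE p Op Wp) m0 scale0r eqxx in Z0.
(* By the Cauchy-Riemann equations phi_u = (c, d) and phi_v = (-d, c), whence the conformal factor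
   m^2 (c^2 + d^2). *)
have [vphi uphi] := CR p Op; rewrite -duE -dvE !DZ vphi.
move: uphi; case: ('D_(e_u R) phi p) => c d /= cd.
have k0 : 0 < c ^+ 2 + d ^+ 2.
  rewrite lt_neqAle addr_ge0 ?sqr_ge0// andbT eq_sym paddr_eq0 ?sqr_ge0//.
  rewrite !sqrf_eq0; apply/negP => /andP[/eqP c0 /eqP d0].
  by apply: cd; rewrite c0 d0.
exists (m p ^+ 2 * (c ^+ 2 + d ^+ 2)); first by rewrite mulr_gt0// exprn_even_gt0.
move: ('D_(e_u R) m p) ('D_(e_v R) m p) => mu mv.
by split; rewrite !qfE !(frE F); ring.
Qed.

Hypothesis local_structure : forall p, M p ->
  exists W Y N S L, exists s t l1 l2 a b : R * R -> R,
    [/\ open_in M W, W p, structure_eqs W o Y N S L s t l1 l2 a b,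
        forall q, W q -> line (y q) = <[Y q]>%VS & forall q, W q -> l1 q != 0].

(** Each clause is checked at one point, with the structure equations around it. There are no
    umbilics because <kappa, S> is l1 up to sign. *)
Lemma isothermic_of_structure : immersion M y -> isothermic M y.
Proof.
move=> imm; split.
  split=> // O phi Z cphi lZ p Op; have [oO phiM _ _ _] := cphi.
  have [W [Y [N [S [L [s [t [l1 [l2 [a [b]]]]]]]]]]] := local_structure (phiM p Op).
  move=> [[oW _] Wp E lineY _].
  have [k k0 [uu vv uv]] := lift_comp_qf oW E lineY cphi lZ Op Wp.
  rewrite qf_Yz qf_Yz_Yzbar uu vv uv subrr !mulr0; split => //.
  by rewrite ltcR mulr_gt0 ?addr_gt0 ?invr_gt0.
move=> W' Y' s' kappa [oW' W'M] canY' H p W'p.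
have [W [Y [N [S [L [s [t [l1 [l2 [a [b]]]]]]]]]]] := local_structure (W'M p W'p).
move=> [[oW _] Wp E lineY l10].
have [k k1 [hr hi]] := hopf_canonical oW oW' E lineY canY' H Wp W'p.
have F := se_frame E Wp.
split; last by apply: eqCV; rewrite ?reV_conj ?imV_conj// hi oppr0.
move=> kappa0; rewrite kappa0 in hr.
have := congr1 (fun x => qf x (S p)) hr.
have -> : reV (0 : 'rV[R[i]]_6) = 0 by apply/rowP => i; rewrite !mxE.
rewrite !qfE !(frE F) mulr0 addr0 mulrN1 => /eqP; rewrite eq_sym mulrN oppr_eq0 mulf_eq0.
rewrite (negPf (l10 p Wp)) orbF => /eqP k0.
by move: k1 => /eqP; rewrite k0 expr0n eq_sym oner_eq0.
Qed.

End Isothermic.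

(** * The polar line and its degeneracy *)

Section PolarLine.
Variables (R : realType) (o : bool) (M W : set (R * R)) (y l : R * R -> quadric R).
Variables (Y N S L : R * R -> 'rV[R]_6) (s t l1 l2 a b : R * R -> R).
Hypotheses (WM : open_in M W) (E : structure_eqs W o Y N S L s t l1 l2 a b).
Hypothesis lineY : forall p, W p -> line (y p) = <[Y p]>%VS.

(** The polar may come from another frame over another lift. Both frames span the same normal plane,
    whose only null lines are those of [L] and [S], and the orientation excludes [S]. *)
Lemma left_polar_line : left_polar o M y l -> forall p, W p -> line (l p) = <[L p]>%VS.
Proof.
move=> pl p Wp; have oW := WM.1.
have [W' [Y' [N' [L' [S' [[oW' _] W'p C' lineL']]]]]] := pl p (WM.2 p Wp).
have F := se_frame E Wp; have F' := framing_frame oW' C' W'p.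
have [canY' [_ HN'] [_ _ HF']] := C'.
have [k k1 [EY Eu Ev _ _]] := canonical_lift_unique oW oW' E lineY canY' Wp W'p.
have kk : k * k = 1 by rewrite -expr2.
have k0 : k != 0 by apply: contra_eq_neq k1 => ->; rewrite expr0n eq_sym oner_eq0.
have nE x := normal_canonical oW oW' E lineY canY' x Wp W'p.
have [[nL' nS'] _ _ _ _] := HF' p W'p.
have [N'V _ _ _ _] := HN' p W'p.
have perp x : Defs.normal Y' p x -> x = - qf x (L p) *: S p - qf x (S p) *: L p.
  move=> /nE nx; have [xY xU xV _] := (normal_vectorP (se_smoothY E) Wp _).1 nx.
  have xN := nx _ (structure_bundleN oW E Wp).
  rewrite {1}(frame_decomp F x) xY xU xV xN.
  by apply/rowP => i; rewrite !mxE; ring.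
(* [N] changes by the same sign as the lift, which makes the orientations of the two frames
   comparable. *)
have N'E : N' p = k *: N p.
  have NL := (nE _).2 (structure_normalL E Wp) _ N'V.
  have NS := (nE _).2 (structure_normalS E Wp) _ N'V.
  have NU : qf (N' p) (du Y p) = 0.
    have := frUN F'; rewrite Eu qfZl => /eqP; rewrite mulf_eq0 (negPf k0) => /eqP <-.
    exact: qfC.
  have NV : qf (N' p) (dv Y p) = 0.
    have := frVN F'; rewrite Ev qfZl => /eqP; rewrite mulf_eq0 (negPf k0) => /eqP <-.
    exact: qfC.
  have NY : qf (N' p) (Y p) = - k.
    rewrite -[LHS]mul1r -kk -mulrA (qfC _ (Y p)) -qfZl -EY (frYN F'); ring.
  have dN := frame_decomp F (N' p).
  rewrite NU NV NY (qfC (N' p) (L p)) NL (qfC (N' p) (S p)) NS in dN.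
  have NN : qf (N' p) (N p) = 0.
    have := frNN F'; rewrite {1}dN !qfE -(qfC (N' p)) -(qfC (N' p)) (qfC (N p)) NY.
    rewrite !mul0r => h; have {h} : 2 * k * qf (N' p) (N p) = 0 by lra.
    by move/eqP; rewrite !mulf_eq0 pnatr_eq0/= (negPf k0)/= => /eqP.
  rewrite dN NN; apply/rowP => i; rewrite !mxE; ring.
have := perp _ nL'; have := perp _ nS'.
move: (- qf (S' p) (L p)) (qf (S' p) (S p)) (- qf (L' p) (L p)) (qf (L' p) (S p)).
move=> x' w' x w S'E L'E.
have xw : x * w = 0.
  have := frLL F'; rewrite L'E !qfE !(frE F) => h; lra.
have xw' : x' * w' = 0.
  have := frSS F'; rewrite S'E !qfE !(frE F) => h; lra.
have det1 : x * w' + x' * w = -1.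
  have := frSL F'; rewrite S'E L'E !qfE !(frE F) => h; lra.
(* If [w] vanished, L' would be a multiple of S and S' one of L, against [oriented_exchange]. *)
have w0 : w != 0.
  apply/eqP => w0; have d1 : - w' * x = 1 by rewrite w0 in det1; lra.
  have x'0 : x' = 0.
    move/eqP: xw'; rewrite mulf_eq0 => /orP[/eqP //|/eqP w'0].
    by move: d1 => /eqP; rewrite w'0 oppr0 mul0r eq_sym oner_eq0.
  have := fr_oriented F'; rewrite EY Eu Ev N'E S'E L'E w0 x'0 !scale0r sub0r subr0 -scaleNr.
  exact: oriented_exchange (fr_oriented F).
have x0 : x = 0 by move/eqP: xw; rewrite mulf_eq0 (negPf w0) orbF => /eqP.
rewrite lineL'// L'E x0 scale0r sub0r -scaleNr; apply/eqP.
rewrite eqEsubv -!memvE memvZ ?memv_line//=; apply/vlineP; exists (- w^-1).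
by rewrite scalerA mulrNN mulVf// scale1r.
Qed.

(** Where l2 vanishes, L_u and L_v are multiples of the single vector Y modulo L, so the
    differential of [L] has a kernel. *)
Lemma polar_nondegenerate : immersion M l -> (forall p, W p -> line (l p) = <[L p]>%VS) ->
  forall p, W p -> l2 p != 0.
Proof.
move=> [_ imm] lineL p Wp; have oW := WM.1; have F := se_frame E Wp.
have sL := se_smoothL E.
have lL : local_lift W l L.
  split=> // q Wq; have Fq := se_frame E Wq; split; [by rewrite (frE Fq)| |exact: lineL].
  apply/eqP => L0; have := frSL Fq; rewrite L0 qf0r => /eqP.
  by rewrite eq_sym oppr_eq0 oner_eq0.
apply/eqP => l20; have Lu := duL_decomp oW E Wp; have Lv := dvL_decomp oW E Wp.
rewrite l20 mulr0 scale0r addr0 in Lu; rewrite l20 mulr0 scale0r subr0 in Lv.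
move: (- qf (du L p) (N p)) (- qf (dv L p) (N p)) Lu Lv => pu pv Lu Lv.
(* In this direction the Y-components cancel, so injectivity gives pu = pv = 0; then (1, 0) is a
   kernel vector as well. *)
have := imm W L WM lL p (pv, - pu) Wp; rewrite (derive_uv _ sL Wp) /= Lu Lv.
have -> : pv *: (pu *: Y p + a p *: L p) + - pu *: (pv *: Y p + b p *: L p) =
    (pv * a p - pu * b p) *: L p by apply/rowP => i; rewrite !mxE; ring.
move=> /(_ (memvZ _ (memv_line _))) [pv0 /eqP].
rewrite oppr_eq0 => /eqP pu0.
have := imm W L WM lL p (1, 0) Wp; rewrite (derive_uv _ sL Wp) /= Lu Lv pu0.
rewrite !scale0r scale1r add0r addr0 => /(_ (memvZ _ (memv_line _))) [/eqP].
by rewrite oner_eq0.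
Qed.

End PolarLine.

Section Transform.
Variable R : realType.
Implicit Types (M W : set (R * R)) (y l : R * R -> quadric R).

(** The invariants are total functions constrained on [W] only, so they can be compared there and
    not as functions. *)
Lemma structure_ext W o (Y N S L : R * R -> 'rV[R]_6)
    (s t l1 l2 a b s' t' l1' l2' a' b' : R * R -> R) :
  (forall p, W p -> [/\ s' p = s p, t' p = t p, l1' p = l1 p & l2' p = l2 p]) ->
  (forall p, W p -> a' p = a p /\ b' p = b p) ->
  structure_eqs W o Y N S L s t l1 l2 a b ->
  structure_eqs W o Y N S L s' t' l1' l2' a' b'.
Proof.
move=> H K E; split.
- exact: se_smoothY E.
- exact: se_smoothN E.
- exact: se_smoothS E.
- exact: se_smoothL E.
- exact: se_frame E.
- exact: se_lapS E.
- exact: se_lapL E.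
- by move=> p Wp; have [-> _ -> ->] := H p Wp; exact: se_hopf E _ Wp.
- by move=> p Wp; have [_ -> _ _] := H p Wp; exact: se_mixed E _ Wp.
- by move=> p Wp; rewrite (K p Wp).1; exact: se_a E _ Wp.
- by move=> p Wp; rewrite (K p Wp).2; exact: se_b E _ Wp.
Qed.

(** [P] is the lift, [Q] its left and [PS] its right null normal; primes refer to the polar of the
    transform. *)
Definition common_structure o W c l lc (P Q P' Q' PN PN' PS PS' : R * R -> 'rV[R]_6)
    (s t l2 a b : R * R -> R) : Prop :=
  [/\ structure_eqs W o P PN PS Q s t (fun=> 2^-1) l2 a b,
      structure_eqs W o P' PN' PS' Q' (fun q => s q + c) t (fun=> 2^-1) l2 a b,
      forall q, W q -> line (l q) = <[P q]>%VS
    & forall q, W q -> line (lc q) = <[P' q]>%VS].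

Section LeftPolar.
Variables (o : bool) (M : set (R * R)) (c : R) (y yc l lc : R * R -> quadric R).
Hypothesis T : spectral_transform o M c y yc.
Hypotheses (pl : left_polar o M y l) (plc : left_polar o M yc lc).
Hypotheses (imm : immersion M l) (immc : immersion M lc).

Lemma left_polar_common p : M p -> exists W P Q P' Q' PN PN' PS PS',
  exists s t l2 a b : R * R -> R, [/\ open_in M W, W p
    & common_structure o W c l lc P Q P' Q' PN PN' PS PS' s t l2 a b].
Proof.
move=> Mp; have [iso isoc H] := T.
have [W [Y [N [L [S [Y' [N' [L' [S']]]]]]]]] := H p Mp.
move=> [s [lam1 [lam2 [alpha [s' [lam1' [lam2' [alpha']]]]]]]].
move=> [[WM Wp] [C I] [C' I'] eqs]; have oW := WM.1.
have E := framing_structure oW WM C I iso.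
have lineY q : W q -> line (y q) = <[Y q]>%VS by case: C => [[[_ h] _] _ _] /h[].
have lineY' q : W q -> line (yc q) = <[Y' q]>%VS by case: C' => [[[_ h] _] _ _] /h[].
have lineL := left_polar_line WM E lineY pl.
have l20 := polar_nondegenerate WM E imm lineL.
have E' : structure_eqs W o Y' N' S' L' (fun p => complex.Re (s p) + c)
    (fun p => complex.Im (s p)) (fun p => complex.Re (lam1 p))
    (fun p => complex.Re (lam2 p)) (fun p => 2 * complex.Re (alpha p))
    (fun p => - 2 * complex.Im (alpha p)).
  apply: structure_ext (framing_structure oW WM C' I' isoc) => q Wq.
    have [-> -> -> _] := eqs q Wq.
    by split=> //; case: (s q) => u v /=; rewrite ?addr0.
  by have [_ _ _ ->] := eqs q Wq.
have lineL' := left_polar_line WM E' lineY' plc.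
(* The gauge that turns lambda_2 into 1/2. It serves both surfaces, because lambda_2 is common to
   them. *)
pose f q := (2 * complex.Re (lam2 q))^-1.
have f0 q : W q -> f q != 0 by move=> Wq; rewrite invr_eq0 mulf_neq0// l20.
have sf : smooth W f.
  apply: smoothV => // [q Wq|]; first by rewrite mulf_neq0// l20.
  by apply: smoothM => //; [exact: smooth_cst|exact: se_smooth_l2 E].
have half q : W q -> f q * complex.Re (lam2 q) = 2^-1.
  by move=> Wq; rewrite /f invfM mulfVK// l20.
have G := structure_polar oW (structure_gauge oW E sf f0) half.
have G' := structure_polar oW (structure_gauge oW E' sf f0) half.
have line_scale (x : 'rV[R]_6) q : W q -> <[x]>%VS = <[f q *: x]>%VS.
  move=> Wq; apply/eqP; rewrite eqEsubv -!memvE memvZ ?memv_line// andbT.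
  by apply/vlineP; exists (f q)^-1; rewrite scalerA mulVf ?scale1r// f0.
do 14?eexists; split; [exact: WM|exact: Wp|split].
- exact: G.
- by apply: structure_ext G' => // q Wq; split => //=; ring.
- by move=> q Wq; rewrite lineL// -line_scale.
- by move=> q Wq; rewrite lineL'// -line_scale.
Qed.

Lemma left_polar_transform : spectral_transform o M c l lc.
Proof.
split.
- apply: (isothermic_of_structure (o := o)) imm => p /left_polar_common.
  move=> [W [P [Q [P' [Q' [PN [PN' [PS [PS']]]]]]]]] [s [t [l2 [a [b]]]]].
  move=> [WM Wp [E _ lineP _]].
  exists W, P, PN, PS, Q, s, t, (fun=> 2^-1), l2, a, b.
  split; [exact: WM|exact: Wp|exact: E|exact: lineP|move=> q _].
  by rewrite invr_eq0 pnatr_eq0.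
- apply: (isothermic_of_structure (o := o)) immc => p /left_polar_common.
  move=> [W [P [Q [P' [Q' [PN [PN' [PS [PS']]]]]]]]] [s [t [l2 [a [b]]]]].
  move=> [WM Wp [_ E _ lineP]].
  exists W, P', PN', PS', Q', (fun q => s q + c), t, (fun=> 2^-1), l2, a, b.
  split; [exact: WM|exact: Wp|exact: E|exact: lineP|move=> q _].
  by rewrite invr_eq0 pnatr_eq0.
move=> p /left_polar_common.
move=> [W [P [Q [P' [Q' [PN [PN' [PS [PS']]]]]]]]] [s [t [l2 [a [b]]]]].
move=> [WM Wp [E E' lineP lineP']]; have oW := WM.1.
exists W, P, PN, Q, PS, P', PN', Q', PS'.
do 8 eexists; split; first by [].
- exact: (conj (structure_framing oW E lineP) (structure_invariants oW E)).
- exact: (conj (structure_framing oW E' lineP') (structure_invariants oW E')).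
move=> q Wq; split => //.
by apply/eqP; rewrite eq_complex /= addr0 !eqxx.
Qed.

End LeftPolar.

Lemma normal_frame_swap o W (Y N L S : R * R -> 'rV[R]_6) :
  normal_frame o W Y N L S -> normal_frame (~~ o) W Y N S L.
Proof.
move=> [sL sS H]; split=> // p Wp; have [[nL nS] LL SS LS or] := H p Wp.
by split=> //; [rewrite qfC|exact: oriented_swap].
Qed.

Lemma invariants_swap W (Y L S : R * R -> 'rV[R]_6) (s lam1 lam2 alpha : R * R -> R[i]) :
  invariants W Y L S s lam1 lam2 alpha ->
  invariants W Y S L s lam2 lam1 (fun p => - alpha p).
Proof.
move=> [H D]; split=> [p Wp|p Wp]; last first.
  have [DL DS] := D p Wp; split; first exact: DS.
  by rewrite (opprK (alpha p)); exact: DL.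
by rewrite (addrC (lam2 p *: _)); exact: H.
Qed.

Lemma spectral_transform_swap o M c y yc :
  spectral_transform o M c y yc -> spectral_transform (~~ o) M c y yc.
Proof.
move=> [iso isoc H]; split=> // p Mp.
have [W [Y [N [L [S [Y' [N' [L' [S']]]]]]]]] := H p Mp.
move=> [s [lam1 [lam2 [alpha [s' [lam1' [lam2' [alpha']]]]]]]].
move=> [WM [[cY YN F] I] [[cY' YN' F'] I'] eqs].
exists W, Y, N, S, L, Y', N', S', L'.
exists s, lam2, lam1, (fun q => - alpha q), s', lam2', lam1', (fun q => - alpha' q).
split; first exact: WM.
- by split; [split; [exact: cY|exact: YN|exact: normal_frame_swap]|exact: invariants_swap I].
- by split; [split; [exact: cY'|exact: YN'|exact: normal_frame_swap]|exact: invariants_swap I'].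
- by move=> q Wq; have [-> -> -> ->] := eqs q Wq.
Qed.

Lemma right_polar_swap o M y r : right_polar o M y r -> left_polar (~~ o) M y r.
Proof.
move=> H p Mp; have [W [Y [N [L [S [WM Wp [cY YN F] h]]]]]] := H p Mp.
by exists W, Y, N, S, L; split=> //; split=> //; exact: normal_frame_swap.
Qed.

End Transform.

Theorem theorem6p1 (R : realType) (o : bool) (M : set (R * R)) (openM : open M)
    (c : R) (y yc : R * R -> quadric R)
    (y_isothermic : isothermic M y) (yc_isothermic : isothermic M yc)
    (yc_transform : spectral_transform o M c y yc) :
  (forall l lc : R * R -> quadric R,
     left_polar o M y l -> left_polar o M yc lc ->
     immersion M l -> immersion M lc ->
     spectral_transform o M c l lc) /\
  (forall r rc : R * R -> quadric R,
     right_polar o M y r -> right_polar o M yc rc ->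
     immersion M r -> immersion M rc ->
     spectral_transform o M c r rc).
Proof.
split=> [l lc pl plc imm immc|r rc pr prc imm immc].
  exact: left_polar_transform yc_transform pl plc imm immc.
(* The left case holds for either orientation: it is applied to the opposite one, and a second swap
   returns to [o]. *)
have yc_transform' := spectral_transform_swap yc_transform.
have T := left_polar_transform yc_transform' (right_polar_swap pr) (right_polar_swap prc) imm immc.
by have := spectral_transform_swap T; rewrite negbK.
Qed.
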